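(* Let $X,Y$ be Banach spaces, let $y=\mathcal{G}(u)+\eta$ with $\mathcal{G}:X\to Y$, where $\eta$ is a $Y$-valued random variable with law $\mathbb{Q}_0$, and let $\mathbb{Q}^u$ be the law of $y$ given $u$. Suppose $\mathbb{Q}^u$ is absolutely continuous with respect to $\mathbb{Q}_0$ and let $\Phi:X\times Y\to\mathbb{R}$ be such that $\frac{d\mathbb{Q}^u}{d\mathbb{Q}_0}(y)=\exp(-\Phi(u;y))$ and $\int_Y\exp(-\Phi(u;y))\,\mathbb{Q}_0(dy)=1$. Assume: (i) there is $\alpha_1>0$ and for every $r>0$ an $M\in\mathbb{R}$ such that $\Phi(u;y)\ge M-\alpha_1\|u\|_X$ for all $u\in X$ and all $y\in Y$ with $\|y\|_Y<r$; (ii) for every $r>0$ there is $K=K(r)>0$ such that $\Phi(u;y)\le K$ for all $u\in X$, $y\in Y$ with $\max\{\|u\|_X,\|y\|_Y\}<r$; (iii) for every $r>0$ there is $L=L(r)>0$ such that $|\Phi(u_1;y)-\Phi(u_2;y)|\le L\|u_1-u_2\|_X$ for all $u_1,u_2\in X$, $y\in Y$ with $\max\{\|u_1\|_X,\|u_2\|_X,\|y\|_Y\}<r$. Suppose that for some $t<\infty$ the space $C^t=C^t(\mathbb{T}^d)$ is continuously embedded in $X$, with embedding constant $c_e$: $\|u\|_X\le c_e\|u\|_{C^t}$. Let $1\le q<\infty$, $s>t+\frac dq$, and $\kappa^*=2\,c_e\,r^*\alpha_1$, with $r^*=r^*(s,t,d,q)$ the constant defined in the context. If $\mu_0$ is a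 $(\kappa,X^{s,q})$ measure with $\kappa>\kappa^*$, then the posterior measure $\mu^y$ (the conditional distribution of $u$ given $y$ when $u\sim\mu_0$) is absolutely continuous with respect to $\mu_0$ and satisfies $$\frac{d\mu^y}{d\mu_0}(u)=\frac{1}{Z(y)}\exp(-\Phi(u;y)),\qquad Z(y)=\int_X\exp(-\Phi(u;y))\,\mu_0(du)<\infty .$$
   Context: $\mathbb{T}^d=(0,1]^d$ is the $d$-dimensional torus, $d\le3$. Wavelet basis: $\{\psi_l\}_{l\ge1}$ is a $\varrho$-regular orthonormal wavelet basis of $L^2(\mathbb{T}^d)$ with $\varrho>s$, i.e. the periodification of a wavelet basis of $L^2(\mathbb{R}^d)$ whose scaling function and mother wavelets $\bar\psi_m$ ($m=1,\dots,2^d-1$) are $\varrho$-regular; a function $f$ is $\varrho$-regular if $f\in C^\varrho$ and for every integer $m\in\mathbb{N}$ there is $C_m$ with $|\partial^\alpha f(x)|\le C_m(1+|x|)^{-m}$ for all multi-indices $|\alpha|\le\varrho$. The basis is ordered by increasing scale: $\psi_1$ is the (periodized) scaling function and, for $j\ge0$, the $\psi_l$ with $2^{jd}<l\le2^{(j+1)d}$ enumerate the scale-$j$ functions $2^{jd/2}\sum_{n\in\mathbb{Z}^d}\bar\psi_m(2^j(x-n)-k)$, $1\le m\le 2^d-1$, $k\in\{0,\dots,2^j-1\}^d$. Prior: a $(\kappa,X^{s,q})$ measure ($\kappa>0$) is the law of the random function $u=\sum_{l=1}^\infty l^{-(\frac sd+\frac12-\frac1q)}(\frac1\kappa)^{\frac1q}\xi_l\psi_l$,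 where $\{\xi_l\}$ are real-valued i.i.d. with density proportional to $\exp(-\frac12|x|^q)$. (Here $\|f\|_{X^{s,q}}=(\sum_l l^{sq/d+q/2-1}|f_l|^q)^{1/q}$ for $f=\sum_l f_l\psi_l$.) Norm: $C^t$ is the Hölder space, identified with $B^t_{\infty,\infty}(\mathbb{T}^d)$, with norm $\|f\|_{C^t}=\sup_{l} l^{\frac td+\frac12}|f_l|$ for $f=\sum_l f_l\psi_l$. Posterior: the joint law of $(u,y)$ is $\pi(du,dy)=\mu_0(du)\,\mathbb{Q}^u(dy)$, and $\mu^y$ is the conditional distribution of $u$ given $y$ under $\pi$. Constant $r^*$: let $c_d=2\pi^{d/2}/\Gamma(d/2)$, $c_0=\int_{\mathbb{R}^d}\exp(-\frac12|x|^q)\,dx$, $c_{01}=c_d^{-1}\int_{\mathbb{R}^d}e^{-|x|/2}\,dx$. Let $r_1=r_1(s,t,d,q)>0$ be a number such that $$\int_{r_1}^\infty x^{(d-k)(\frac{s-t}{d}-\frac1q)}\exp\left(-\tfrac12x^{\frac{s-t}{d}-\frac1q}\right)dx<\frac{c_{01}}{4(d+1)}\,\frac{1}{2^{k+1}\binom dk},\qquad k=0,\dots,d,$$ and let $c_{q,d}=(2^d q\,c_0/c_d)^{1/(d-q+1)}$ if $1\le q<1+\frac34$, and $c_{q,d}=\max\{1,2^{d+2}q\,c_0/c_d\}$ if $q\ge1+\frac34$. Then $r^*=(\ln2)\max\{r_1,c_{q,d}\}$. *)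

(* Defs.v *)
From HB Require Import structures.
From mathcomp Require Import all_boot all_order all_algebra.
From mathcomp Require Import all_classical all_reals all_analysis.

Set Implicit Arguments.
Unset Strict Implicit.
Unset Printing Implicit Defensive.

Import Order.TTheory GRing.Theory Num.Theory.
Import numFieldNormedType.Exports.

Local Open Scope classical_set_scope.
Local Open Scope ring_scope.

(** Lebesgue measure on R^d, realised on d-tuples: [lebesgue_tuple d.+1] is the
    image of [lebesgue_measure \x lebesgue_tuple d] under [cons_pair]. *)

Section lebesgue_cons.
Context {R : realType}.
Local Notation T := (measurableTypeR R).
Variables (n : nat) (m : {sigma_finite_measure set (n.-tuple T) -> \bar R}).

Definition cons_pair (p : T * n.-tuple T) : n.+1.-tuple T :=
  [the n.+1.-tuple T of p.1 :: p.2].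

Lemma measurable_cons_pair : measurable_fun setT cons_pair.
Proof.
by apply: measurable_cons; [exact: measurable_fst|exact: measurable_snd].
Qed.

Definition lebesgue_cons : set (n.+1.-tuple T) -> \bar R :=
  pushforward (@lebesgue_measure R \x m)%E cons_pair.

Let lebesgue_cons0 : lebesgue_cons set0 = 0%E.
Proof. by rewrite /lebesgue_cons /pushforward preimage_set0 measure0. Qed.

Let lebesgue_cons_ge0 A : (0 <= lebesgue_cons A)%E.
Proof. by rewrite /lebesgue_cons /pushforward; exact: measure_ge0. Qed.

Let lebesgue_cons_sigma_additive : semi_sigma_additive lebesgue_cons.
Proof.
rewrite /lebesgue_cons; apply: measure_semi_sigma_additive => //.
exact: measurable_cons_pair.
Qed.

HB.instance Definition _ := isMeasure.Build _ _ _ lebesgue_cons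
  lebesgue_cons0 lebesgue_cons_ge0 lebesgue_cons_sigma_additive.

Let lebesgue_cons_sigma_finite : sigma_finite setT lebesgue_cons.
Proof.
have [F UF mF] : sigma_finite setT (@lebesgue_measure R \x m)%E.
  have /sigma_finiteP[F [TF ndF Foo]] := sigma_finiteT (@lebesgue_measure R).
  have /sigma_finiteP[H [TH ndH Hoo]] := sigma_finiteT m.
  exists (fun n => F n `*` H n) => [|k].
    rewrite -setXTT TF TH predeqE => -[x y]; split.
      move=> [/= [i _ Fix] [k _ Hky]]; exists (maxn i k) => //; split.
      - by move: x Fix; exact/subsetPset/ndF/leq_maxl.
      - by move: y Hky; exact/subsetPset/ndH/leq_maxr.
    by move=> [i _ []/= ? ?]; split; exists i.
  have [? ?] := Foo k; have [? ?] := Hoo k.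
  split; first exact: measurableX.
  by rewrite product_measure1E// lte_mul_pinfty// ge0_fin_numE.
pose un (t : n.+1.-tuple T) : T * n.-tuple T := (thead t, [tuple of behead t]).
have unK : cancel cons_pair un.
  move=> [x t]; rewrite /un /cons_pair /= theadE; congr pair.
  exact/val_inj.
have mun : measurable_fun setT un.
  apply: measurable_fun_pair; last exact: measurable_behead.
  exact: measurable_tnth.
exists (fun i => un @^-1` F i).
  by rewrite -preimage_bigcup -UF preimage_setT.
move=> i; have [mFi Foo] := mF i; split.
  by rewrite -[X in measurable X]setTI; exact: mun.
rewrite /lebesgue_cons /pushforward -comp_preimage.
by rewrite (_ : un \o cons_pair = id)//; apply/funext => p /=; exact: unK.
Qed.

HB.instance Definition _ := Measure_isSigmaFinite.Build _ _ _ lebesgue_cons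
  lebesgue_cons_sigma_finite.

End lebesgue_cons.

Fixpoint lebesgue_tuple {R : realType} (d : nat) :
    {sigma_finite_measure set (d.-tuple (measurableTypeR R)) -> \bar R} :=
  if d is n.+1 then lebesgue_cons (lebesgue_tuple n)
  else \d_([tuple] : 0.-tuple (measurableTypeR R)).

Section euclidean.
Context {R : realType} (d : nat).
Local Notation mu := (@lebesgue_tuple R d).
Implicit Types (f g : 'rV[R]_d -> R) (D : set (d.-tuple (measurableTypeR R))).

Definition vec (x : d.-tuple (measurableTypeR R)) : 'rV[R]_d :=
  \row_i (tnth x i : R).

(** The library norm on ['rV[R]_d] is the sup norm. *)
Definition enorm (x : 'rV[R]_d) : R := Num.sqrt (\sum_i x 0 i ^+ 2).

(** Functions on the torus are 1-periodic functions on R^d, integrated over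
    the fundamental domain (0,1]^d. *)
Definition torus : set (d.-tuple (measurableTypeR R)) :=
  [set x | forall i, (0 : R) < tnth x i <= 1].

(** [partial [:: i1; ...; ik] f] is the iterated partial derivative
    d_{i1} ... d_{ik} f. *)
Definition partial (w : seq 'I_d) f : 'rV[R]_d -> R :=
  foldr (fun i g x => 'D_(delta_mx 0 i) g x) f w.

Definition regular (rho : nat) f : Prop :=
  forall w : seq 'I_d, (size w <= rho)%N ->
  [/\ continuous (partial w f),
      (size w < rho)%N ->
        forall i x, derivable (partial w f) x (delta_mx 0 i)
    & forall m : nat, exists C : R, forall x,
        `|partial w f x| <= C * (1 + enorm x) ^- m].

Definition square_integrable D f : Prop :=
  measurable_fun D (f \o vec) /\
  (\int[mu]_(x in D) (f (vec x) ^+ 2)%:E < +oo)%E.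

Definition inner D f g : R := \int[mu]_(x in D) (f (vec x) * g (vec x)).

Definition orthonormal_basis D (I : eqType) (e : I -> 'rV[R]_d -> R) : Prop :=
  [/\ forall i, square_integrable D (e i),
      forall i j, inner D (e i) (e j) = (i == j)%:R
    & forall f, square_integrable D f -> (forall i, inner D f (e i) = 0) ->
        {ae mu, forall x, D x -> f (vec x) = 0}].

End euclidean.

Section wavelets.
Context {R : realType} (d : nat).
Implicit Types f : 'rV[R]_d -> R.

(** x |-> 2^{jd/2} f (2^j x - k) *)
Definition dilate (j : nat) (k : 'rV[int]_d) f : 'rV[R]_d -> R := fun x =>
  2 `^ (j%:R * d%:R / 2) * f (2 ^+ j *: x - map_mx intr k).

Definition wavelet_system (phi : 'rV[R]_d -> R)
    (psi : 'I_(2 ^ d).-1 -> 'rV[R]_d -> R)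
    (i : 'rV[int]_d + 'I_(2 ^ d).-1 * nat * 'rV[int]_d) : 'rV[R]_d -> R :=
  match i with
  | inl k => dilate 0 k phi
  | inr (m, j, k) => dilate j k (psi m)
  end.

(** The sum of f (x - n) over n in Z^d, as the limit of the sums over the cubes
    {-N, ..., N}^d. *)
Definition periodize f : 'rV[R]_d -> R := fun x =>
  limn (fun N : nat => \sum_(n : {ffun 'I_d -> 'I_N.*2.+1})
    f (x - \row_i ((n i)%:R - N%:R))).

(** Indices are shifted by one: [psi l] is the (l+1)-st basis function, so that
    scale j occupies the indices 2^{jd} <= l < 2^{(j+1)d}. *)
Definition wavelet_basis (rho : nat) (psi : nat -> 'rV[R]_d -> R) : Prop :=
  @orthonormal_basis R d (@torus R d) nat psi /\
  exists (phi : 'rV[R]_d -> R) (psib : 'I_(2 ^ d).-1 -> 'rV[R]_d -> R),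
  [/\ regular rho phi,
      forall m, regular rho (psib m),
      orthonormal_basis setT (wavelet_system phi psib),
      psi 0 = periodize phi
    & forall j : nat,
        exists e : 'I_(2 ^ d).-1 * {ffun 'I_d -> 'I_(2 ^ j)} -> nat,
        set_bij setT [set l | (2 ^ (j * d) <= l < 2 ^ (j.+1 * d))%N] e /\
        forall m k,
          psi (e (m, k)) = periodize (dilate j (\row_i (k i)%:Z) (psib m))].

End wavelets.

Section generalized_functions.
Context {R : realType} (d : nat) (psi : nat -> 'rV[R]_d -> R).

(** For t <= 0 the elements of C^t are not functions.  They are taken here as
    generalised functions with the finite linear combinations of the wavelets
    as test functions: every function g in L^2(T^d) acts by h |-> int g h, and
    the wavelet coefficients are f_l = f (psi l). *)
Definition wavelet_span : set ('rV[R]_d -> R) :=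
  [set h | exists (n : nat) (a : nat -> R),
     h = fun x => \sum_(l < n) a l * psi l x].

(** The value 0 outside the test space makes equality of functionals the same
    as equality on test functions. *)
Definition generalized_function (f : ('rV[R]_d -> R) -> R) : Prop :=
  (forall (a : R) g h, wavelet_span g -> wavelet_span h ->
     f (fun x => a * g x + h x) = a * f g + f h) /\
  (forall h, ~ wavelet_span h -> f h = 0).

(** The generalised function sum_l c_l psi_l. *)
Definition wavelet_series (c : nat -> R) : ('rV[R]_d -> R) -> R := fun h =>
  if `[< wavelet_span h >]
  then limn (series (fun l => c l * inner (@torus R d) (psi l) h)) else 0.

Definition holder_norm (t : R) (f : ('rV[R]_d -> R) -> R) : \bar R :=
  ereal_sup (range (fun l : nat =>
    (l.+1%:R `^ (t / d%:R + 2^-1) * `|f (psi l)|)%:E)).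

Definition holder_space (t : R) : set (('rV[R]_d -> R) -> R) :=
  [set f | generalized_function f /\ (holder_norm t f < +oo)%E].

(** Only the values of [iota] on C^t matter. *)
Definition continuous_embedding (t : R) (X : normedModType R)
    (iota : (('rV[R]_d -> R) -> R) -> X) (ce : R) : Prop :=
  [/\ forall (a : R) f g, holder_space t f -> holder_space t g ->
        iota (fun h => a * f h + g h) = a *: iota f + iota g,
      set_inj (holder_space t) iota
    & forall f, holder_space t f -> `|iota f| <= ce * fine (holder_norm t f)].

End generalized_functions.

(** A Banach space with its Borel sigma-algebra. *)
Notation borel X := (g_sigma_algebraType (@open X)).

Definition has_density {R : realType} {d} {T : measurableType d}
    (mu : set T -> \bar R) (f : T -> R) (nu : set T -> \bar R) : Prop :=
  measurable_fun setT f /\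
  forall A, measurable A -> nu A = (\int[mu]_(x in A) (f x)%:E)%E.

Definition mutually_independent {R : realType} {d} {T : measurableType d}
    (P : probability T R) (xi : nat -> {RV P >-> R}) : Prop :=
  forall (s : seq nat) (A : nat -> set R), uniq s ->
    (forall i, measurable (A i)) ->
    P (\bigcap_(i in [set` s]) xi i @^-1` A i) =
    (\prod_(i <- s) P (xi i @^-1` A i))%E.

Section besov_prior.
Context {R : realType} (d : nat) (psi : nat -> 'rV[R]_d -> R).

Definition prior_coefficient (s q kappa : R) (l : nat) : R :=
  l.+1%:R `^ (- (s / d%:R + 2^-1 - q^-1)) * (kappa^-1) `^ (q^-1).

(** [mu] is the law of iota (u), u = sum_l prior_coefficient l * xi_l psi_l. *)
Definition besov_measure (s q kappa : R) (X : completeNormedModType R)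
    (iota : (('rV[R]_d -> R) -> R) -> X) (mu : probability (borel X) R) : Prop :=
  0 < kappa /\
  exists (dO : measure_display) (Omega : measurableType dO)
    (P : probability Omega R) (xi : nat -> {RV P >-> R})
    (U : {RV P >-> borel X}),
  [/\ mutually_independent xi,
      exists2 c : R, 0 < c & forall l,
        has_density lebesgue_measure
          (fun x : R => c * expR (- (`|x| `^ q) / 2)) (distribution P (xi l)),
      {ae P, forall w, U w = iota (wavelet_series psi
         (fun l => prior_coefficient s q kappa l * xi l w))}
    & forall A, measurable A -> mu A = distribution P U A].

End besov_prior.

Section constants.
Context {R : realType}.

Definition Gamma (z : R) : R :=
  \int[lebesgue_measure]_(x in `]0, +oo[) (x `^ (z - 1) * expR (- x)).

Definition c_d (d : nat) : R := 2 * pi `^ (d%:R / 2) / Gamma (d%:R / 2).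

Definition c_0 (d : nat) (q : R) : R :=
  \int[lebesgue_tuple d]_x expR (- (enorm (vec x) `^ q) / 2).

Definition c_01 (d : nat) : R :=
  (c_d d)^-1 * \int[lebesgue_tuple d]_x expR (- enorm (vec x) / 2).

Definition r1_condition (s t : R) (d : nat) (q r1 : R) : Prop :=
  0 < r1 /\
  let gamma := (s - t) / d%:R - q^-1 in
  forall k : nat, (k <= d)%N ->
  (\int[lebesgue_measure]_(x in `[r1, +oo[)
     (x `^ ((d%:R - k%:R) * gamma) * expR (- (x `^ gamma) / 2))%:E <
   (c_01 d / (4 * (d.+1)%:R) * (2 ^+ k.+1 * 'C(d, k)%:R)^-1)%:E)%E.

Definition c_qd (q : R) (d : nat) : R :=
  if q < 1 + 3 / 4
  then (2 ^+ d * q * c_0 d q / c_d d) `^ (d%:R - q + 1)^-1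
  else Num.max 1 (2 ^+ d.+2 * q * c_0 d q / c_d d).

Definition rstar (r1 q : R) (d : nat) : R := ln 2 * Num.max r1 (c_qd q d).

End constants.

Section bayes.
Context {R : realType} {X Y : completeNormedModType R}.

(** The law of y = G u + eta given u, where eta has law Q0 and is independent
    of u. *)
Definition data_law (G : X -> Y) (Q0 : probability (borel Y) R) (u : X) :
    set (borel Y) -> \bar R :=
  pushforward Q0 (fun eta : borel Y => G u + eta : borel Y).

(** [pi] is the law mu0(du) Q^u(dy) of (u, y). *)
Definition joint_law (mu0 : probability (borel X) R)
    (Q : X -> set (borel Y) -> \bar R)
    (pi : probability (borel X * borel Y)%type R) : Prop :=
  forall (A : set (borel X)) (B : set (borel Y)), measurable A -> measurable B ->
    pi (A `*` B) = (\int[mu0]_(u in A) Q u B)%E.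

(** [k] is a version of the conditional distribution of u given y under [pi]. *)
Definition conditional_law (pi : probability (borel X * borel Y)%type R)
    (k : R.-pker (borel Y) ~> (borel X)) : Prop :=
  forall (A : set (borel X)) (B : set (borel Y)), measurable A -> measurable B ->
    pi (A `*` B) = (\int[pushforward pi snd]_(y in B) k y A)%E.

Definition evidence (mu0 : probability (borel X) R) (Phi : X -> Y -> R) (y : Y)
    : \bar R :=
  (\int[mu0]_u (expR (- Phi u y))%:E)%E.

Definition bayes_formula (mu0 : probability (borel X) R) (Phi : X -> Y -> R)
    (y : Y) (mu : set (borel X) -> \bar R) : Prop :=
  mu `<< mu0 /\
  has_density mu0 (fun u : borel X =>
    (fine (evidence mu0 Phi y))^-1 * expR (- Phi u y)) mu.

End bayes.

(* Main.v *)
Require Import Defs.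
From HB Require Import structures.
From mathcomp Require Import all_boot all_order all_algebra.
From mathcomp Require Import all_classical all_reals all_analysis.
From mathcomp Require Import measurable_realfun ring lra.

(** Three facts carry the proof.

    Exponential moment: with [gamma = (s - t)/d - 1/q > 0], the norm of [u] in
    [X] is at most [ce * kappa^(-1/q) * sup_l l^(-gamma) |xi_l|].  For
    [0 < b < p] and [z = l^gamma] one has
    [exp (b y / z) <= e + exp (- (p - b) z / b) exp (p y)], by distinguishing
    whether [b y <= z]; the weights are summable in [l], so
    [exp (b sup_l l^(-gamma) |xi_l|)] is bounded by an integrable series as soon
    as [E exp (p |xi_l|)] is finite, and neither independence nor sharp tail
    estimates are needed.  For [q > 1] every [p] is allowed; for [q = 1] one
    needs [p < 1/2], i.e. [kappa > 2 ce alpha1], which follows from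
    [kappa > kappa^*] because [r^* >= 1].

    Separability: the same series with [gamma / 2] instead of [gamma] shows that
    almost surely [l^(-gamma) xi_l --> 0], so that [mu0] lives on the closure of
    a countable set even when [X] is not separable.  On that closure
    [exp (- Phi)], continuous in [u] and measurable in [y], is jointly
    measurable, and finitely many balls at a time determine a Borel measure.

    Bayes: by Tonelli the law of [y] has density [Z] with respect to [Q0], hence
    the kernel [exp (- Phi(u; y)) / Z(y) mu0(du)] is a conditional law, and any
    other one agrees with it on a countable pi-system outside a null set. *)

Set Implicit Arguments.
Unset Strict Implicit.
Unset Printing Implicit Defensive.
Import Order.TTheory GRing.Theory Num.Theory.
Import numFieldNormedType.Exports.
Local Open Scope classical_set_scope.
Local Open Scope ring_scope.

(** * Integration against a measure given by a density *)

Section density.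
Local Open Scope ereal_scope.
Context {R : realType} {d : measure_display} {T : measurableType d}.
Variables (mu nu : {measure set T -> \bar R}) (f : T -> R).
Hypotheses (f_ge0 : forall x, (0 <= f x)%R) (nu_density : has_density mu f nu).

Import HBNNSimple.

Lemma sintegral_density (h : {nnsfun T >-> R}) :
  \int[nu]_x (h x)%:E = \int[mu]_x (h x * f x)%:E.
Proof.
have [mf nuE] := nu_density.
transitivity (\int[nu]_x (\sum_(y \in range h) (y * \1_(h @^-1` [set y]) x)%:E)).
  by apply: eq_integral => x _; rewrite fimfunE -fsumEFin.
have mind y : measurable_fun setT (fun x : T => (y * \1_(h @^-1` [set y]) x)%:E : \bar R).
  by apply/measurable_EFinP; exact: measurable_funM.
rewrite ge0_integral_fsum//; last by move=> y x _; exact: nnfun_muleindic_ge0.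
transitivity (\int[mu]_x (\sum_(y \in range h)
    (y * \1_(h @^-1` [set y]) x)%:E * (f x)%:E)).
  rewrite ge0_integral_fsum//; last 2 first.
  - by move=> y; apply: emeasurable_funM => //; exact/measurable_EFinP.
  - by move=> y x _; rewrite mule_ge0 ?lee_fin// -lee_fin nnfun_muleindic_ge0.
  apply: eq_fsbigr => y yh.
  have y0 : (0 <= y)%R by move: yh; rewrite inE => -[x _ <-].
  under eq_integral do rewrite EFinM.
  rewrite ge0_integralZl//; last exact/measurable_EFinP.
  rewrite integral_indic// setIT nuE//.
  under [RHS]eq_integral do rewrite EFinM -muleA.
  rewrite ge0_integralZl//; last 2 first.
  - by apply: emeasurable_funM => //; exact/measurable_EFinP.
  - by move=> x _; rewrite mule_ge0 ?lee_fin.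
  congr (_ * _); rewrite integral_mkcond; apply: eq_integral => x _.
  by rewrite epatch_indic/= muleC.
apply: eq_integral => x _.
rewrite -ge0_mule_fsuml => [|y]; last exact: nnfun_muleindic_ge0.
by rewrite fsumEFin// -fimfunE -EFinM.
Qed.

(** Monotone convergence along the increasing simple approximations of [g], extended by zero off
    [A], reduces the claim to simple functions; there it is the definition of [has_density] on each
    fibre. *)
Lemma ge0_integral_density (A : set T) (g : T -> \bar R) : measurable A ->
  measurable_fun A g -> (forall x, A x -> 0 <= g x) ->
  \int[nu]_(x in A) g x = \int[mu]_(x in A) (g x * (f x)%:E).
Proof.
move=> mA mg g0; rewrite integral_mkcond [RHS]integral_mkcond.
have [mf _] := nu_density.
have mgA : measurable_fun setT (g \_ A).
  by apply/(measurable_restrictT _ _).1.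
have gA0 x : 0 <= (g \_ A) x by exact: erestrict_ge0.
pose h := nnsfun_approx measurableT mgA.
have hg x : (h n x)%:E @[n --> \oo] --> (g \_ A) x.
  by apply: cvg_nnsfun_approx => // ? _; exact: gA0.
have nd x : {homo (fun n => (h n x)%:E) : n m / (n <= m)%N >-> n <= m}.
  by move=> n m nm; rewrite lee_fin; exact/lefP/nd_nnsfun_approx.
transitivity (limn (fun n => \int[nu]_x (h n x)%:E)).
  rewrite -monotone_convergence//.
  - by apply: eq_integral => x _; exact/esym/cvg_lim.
  - by move=> n; exact/measurable_EFinP.
  - by move=> n x _; rewrite lee_fin.
transitivity (limn (fun n => \int[mu]_x (h n x * f x)%:E)).
  by congr (limn _); apply/funext => n; exact: sintegral_density.
rewrite -monotone_convergence//.
- apply: eq_integral => x _; apply/cvg_lim => //.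
  rewrite (_ : patch _ _ _ x = (g \_ A) x * (f x)%:E); last first.
    by rewrite !patchE; case: ifPn; rewrite ?mul0e.
  rewrite (_ : (fun n => _) = (fun n => (h n x)%:E * (f x)%:E)); last first.
    by apply/funext => n; rewrite EFinM.
  exact: cvgeZr.
- by move=> n; apply/measurable_EFinP; exact: measurable_funM.
- by move=> n x _; rewrite lee_fin mulr_ge0.
- by move=> x _ n m nm; rewrite lee_fin ler_wpM2r//; exact/lefP/nd_nnsfun_approx.
Qed.

End density.

(** * Measurability and uniqueness over a separable support *)

Lemma open_measurable_borel (X : ptopologicalType) (A : set X) :
  open A -> measurable (A : set (borel X)).
Proof. by move=> oA; apply: sub_sigma_algebra. Qed.

Lemma closed_measurable_borel (X : ptopologicalType) (A : set X) :
  closed A -> measurable (A : set (borel X)).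
Proof.
move=> cA; rewrite -[A]setCK; apply: measurableC.
by apply: open_measurable_borel; rewrite openC.
Qed.

Lemma continuous_measurable_borel (R : realType) (X : ptopologicalType)
  (f : X -> R) : continuous f -> measurable_fun setT (f : borel X -> R).
Proof.
move=> cf; apply: (measurability _ (RGenOInfty.measurableE R)).
move=> /= _ [_ [a ->]] <-; rewrite setTI; apply: open_measurable_borel.
by apply: open_comp => // x _; exact: cf.
Qed.

Section separable_support.
Context {R : realType} {X : normedModType R} (z : nat -> X).

Definition near_pt (nk : nat * nat) : set X :=
  [set u | `|u - z nk.2| < nk.1.+1%:R^-1].

Lemma open_near_pt nk : open (near_pt nk).
Proof.
rewrite /near_pt (_ : [set _ | _] = (fun u => `|u - z nk.2|) @^-1` `]-oo, nk.1.+1%:R^-1[).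
  apply: open_comp => // u _; apply: cvg_norm.
  by apply: cvgB; [exact: cvg_id|exact: cvg_cst].
by apply/seteqP; split => u /=; rewrite in_itv.
Qed.

Lemma closure_near_pt n u : closure (range z) u -> exists k, near_pt (n, k) u.
Proof.
move=> /(_ (ball u n.+1%:R^-1)) [|_ [[k _ <-] uk]]; first exact: nbhsx_ballx.
by exists k; move: uk; rewrite -ball_normE.
Qed.

Definition first_near n u : nat :=
  xget 0%N [set k | seqDU (fun k => near_pt (n, k)) k u].

Lemma first_nearP n u : closure (range z) u ->
  seqDU (fun k => near_pt (n, k)) (first_near n u) u.
Proof.
move=> /(closure_near_pt n)[k uk].
have : (\bigcup_k near_pt (n, k)) u by exists k.
by rewrite seqDU_bigcup_eq => -[j _ uj]; apply: (xgetPex 0%N (P := [set k | seqDU (fun k => near_pt (n, k)) k u])); exists j.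
Qed.

Lemma first_near_cvg u : closure (range z) u ->
  (z (first_near n u)) @[n --> \oo] --> u.
Proof.
move=> Su; apply/cvgrPdist_lt => e e0.
near=> n; have /(@subset_seqDU _ _ _ _)/= := first_nearP n Su.
rewrite /near_pt/= => /lt_trans; apply.
by near: n; exact: near_infty_natSinv_lt (PosNum e0).
Unshelve. all: by end_near. Qed.

Lemma measurable_seqDU_near_pt n k :
  measurable (seqDU (fun k => near_pt (n, k)) k : set (borel X)).
Proof.
apply: (@seqDU_measurable _ (borel X)) => j.
by apply: open_measurable_borel; exact: open_near_pt.
Qed.

(** Replacing [u] by [z (first_near n u)] leaves countably many sections in [y], each measurable. On
    the closure these approximants converge pointwise by continuity in [u]. *)
Lemma measurable_caratheodory d (T : measurableType d) (F : X -> T -> R) :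
  (forall u, measurable_fun setT (F u)) -> (forall y, continuous (F^~ y)) ->
  measurable_fun ((closure (range z) : set (borel X)) `*` [set: T])
    (fun p : borel X * T => F p.1 p.2).
Proof.
move=> mF cF.
have mS : measurable (closure (range z) : set (borel X)).
  by apply: closed_measurable_borel; exact: closed_closure.
apply: (@measurable_fun_cvg _ (borel X * T)%type R _
  (fun n p => F (z (first_near n p.1)) p.2)); last first.
  move=> [u y] [/= Su _]; have := cF y u.
  exact: (@cvg_comp _ _ _ (fun n => z (first_near n u)) (F^~ y) \oo _ _ (first_near_cvg Su)).
move=> n mD /= B mB.
rewrite (_ : _ `&` _ = \bigcup_k ((closure (range z) `&`
  seqDU (fun k => near_pt (n, k)) k) `*` (F (z k) @^-1` B))).
  apply: bigcupT_measurable => k; apply: measurableX.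
    by apply: measurableI => //; exact: measurable_seqDU_near_pt.
  by rewrite -[X in measurable X]setTI; exact: mF.
apply/seteqP; split => [[u y] [[/= Su _] Bu]|[u y] [k _ [/= [Su uk] By]]].
  by exists (first_near n u) => //; split => //=; split => //; exact: first_nearP.
split => //=; suff -> : first_near n u = k by [].
have := @trivIset_seqDU _ (fun k => near_pt (n, k)).
by move/(_ _ _ I I); apply; exists u; split => //; exact: first_nearP.
Qed.

(* [None] stands for the support itself, [Some nk] for a ball around [z nk.2] *)
Definition base_set (i : option (nat * nat)) : set (borel X) :=
  if i is Some nk then near_pt nk else closure (range z).

(** Finite intersections form a pi-system; indexing by finite sequences keeps it countable, and the
    empty sequence yields the whole space. *)
Definition base_inter (s : seq (option (nat * nat))) : set (borel X) :=
  \bigcap_(i in [set` s]) base_set i.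

Lemma measurable_base_inter s : measurable (base_inter s).
Proof.
apply: fin_bigcap_measurable => [|[nk|] _].
- exact: finite_seq.
- by apply: open_measurable_borel; exact: open_near_pt.
- by apply: closed_measurable_borel; exact: closed_closure.
Qed.

(** The sets with this property form a sigma-algebra. It contains the open sets, because on the
    closure an open set is the union of the countably many balls [near_pt] inside it. *)
Lemma sigma_base_inter_trace (A : set (borel X)) : measurable A ->
  <<s range base_inter >> (A `&` closure (range z)).
Proof.
pose GT : measurableType _ := g_sigma_algebraType (range base_inter).
have mS : measurable (closure (range z) : set GT).
  apply: sub_sigma_algebra; exists [:: None] => //.
  apply/seteqP; split => [x bx|x Sx i]; first by apply: (bx None); rewrite /= inE.
  by rewrite /= inE => /eqP ->.
have mV nk : measurable (near_pt nk : set GT).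
  apply: sub_sigma_algebra; exists [:: Some nk] => //.
  apply/seteqP; split => [x bx|x Vx i]; first by apply: (bx (Some nk)); rewrite /= inE.
  by rewrite /= inE => /eqP ->.
apply: (@smallest_sub _ (sigma_algebra setT) open
  [set A | measurable (A `&` closure (range z) : set GT)]) => [|O oO /=].
  split => /= [|B mB|F mF].
  - by rewrite set0I.
  - rewrite setTD (_ : _ `&` _ = closure (range z) `\` (B `&` closure (range z))).
      exact: measurableD.
    by apply/seteqP; split => x /=; tauto.
  - by rewrite setI_bigcupl; exact: bigcupT_measurable.
rewrite (_ : _ `&` _ = \bigcup_(nk in [set nk | near_pt nk `<=` O])
    (near_pt nk `&` closure (range z))).
  rewrite bigcup_mkcond; apply: countable_bigcupT_measurable => // nk.
  by case: ifPn => // _; exact: measurableI.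
apply/seteqP; split => [x [Ox Sx]|x [nk /= VO [Vx Sx]]]; last by split => //; exact: VO.
(* A ball of radius below [e / 2] that contains [x] stays inside the [e]-ball around [x]. *)
have /nbhs_ballP[e /= e0 eO] : nbhs x O by exact: open_nbhs_nbhs.
have [n ne] : exists n, n.+1%:R^-1 < e / 2.
  near \oo => n; exists n; near: n.
  exact: near_infty_natSinv_lt (PosNum (divr_gt0 e0 (ltr0n _ 2))).
have [k xk] := closure_near_pt n Sx.
exists (n, k) => //= u uk.
apply: eO; rewrite -ball_normE /= -(subrK (z k) x) -addrA (splitr e).
apply: (le_lt_trans (ler_normD _ _)); apply: ltrD; apply: lt_trans ne => //.
by rewrite distrC.
Unshelve. all: by end_near. Qed.

(** Both measures vanish off the closure, so only traces matter, and uniqueness of finite measures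
    on a generating pi-system applies to them. *)
Lemma measure_eq_base_inter (m1 m2 : {measure set (borel X) -> \bar R}) :
  (m1 setT < +oo)%E -> m1 (~` closure (range z)) = 0%E ->
  m2 (~` closure (range z)) = 0%E ->
  (forall s, m1 (base_inter s) = m2 (base_inter s)) ->
  forall A, measurable A -> m1 A = m2 A.
Proof.
move=> m1oo m1S m2S m12 A mA.
have mS : measurable (closure (range z) : set (borel X)).
  by apply: closed_measurable_borel; exact: closed_closure.
have base0 : base_inter [::] = setT.
  by apply/seteqP; split => // x _ i; rewrite /= inE.
have trace (m : {measure set (borel X) -> \bar R}) :
    m (~` closure (range z)) = 0%E -> m A = m (A `&` closure (range z)).
  move=> mS0; rewrite [LHS](@measureDI _ _ _ m _ (closure (range z)))//.
  rewrite [X in (X + _)%E](_ : _ = 0%E) ?add0e//.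
  apply: (subset_measure0 (mu := m) _ _ _ mS0).
  - exact: measurableD.
  - exact: measurableC.
  - by move=> x [].
rewrite (trace _ m1S) (trace _ m2S).
apply: (g_sigma_algebra_measure_unique (range base_inter) _ (fun=> setT)) => //.
- by move=> _ [s _ <-]; exact: measurable_base_inter.
- by move=> _; exists [::].
- by rewrite bigcup_const.
- move=> _ _ [s _ <-] [s' _ <-]; exists (s ++ s') => //.
  apply/seteqP; split => [x xs|x [xs xs'] i].
    by split=> i /= si; apply: xs; rewrite /= mem_cat si ?orbT.
  by rewrite /= mem_cat => /orP[|]; [exact: xs|exact: xs'].
- by move=> _ [s _ <-].
- exact: sigma_base_inter_trace.
Qed.

End separable_support.

(** * Bayes' formula *)

Section density_measure.
Local Open Scope ereal_scope.
Context {R : realType} {d : measure_display} {T : measurableType d}.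
Variables (mu : {measure set T -> \bar R}) (f : T -> R).
Hypotheses (mf : measurable_fun setT f) (f_ge0 : forall x, (0 <= f x)%R).

(** The two proofs are arguments so that the measure structure attached to this constant can read
    them off the term. *)
Definition density_measure (_ : measurable_fun setT f)
  (_ : forall x, (0 <= f x)%R) (A : set T) : \bar R := \int[mu]_(x in A) (f x)%:E.

Local Notation nu := (density_measure mf f_ge0).

Let density_measure0 : nu set0 = 0.
Proof. exact: integral_set0. Qed.

Let density_measure_ge0 A : 0 <= nu A.
Proof. by apply: integral_ge0 => x _; rewrite lee_fin. Qed.

Let density_measure_sigma_additive : semi_sigma_additive nu.
Proof.
move=> F mF tF mUF; rewrite /density_measure ge0_integral_bigcup//=.
- apply: is_cvg_nneseries => n _ _.
  by apply: integral_ge0 => x _; rewrite lee_fin.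
- by apply: measurable_funTS; exact/measurable_EFinP.
- by move=> x _; rewrite lee_fin.
Qed.

HB.instance Definition _ := isMeasure.Build _ _ _ nu
  density_measure0 density_measure_ge0 density_measure_sigma_additive.

End density_measure.

Section make_probability_kernel.
Context {R : realType} {d d' : measure_display}.
Context {T : measurableType d} {T' : measurableType d'}.
Variable k : T -> {measure set T' -> \bar R}.
Hypothesis mk : forall A, measurable A -> measurable_fun setT (k ^~ A).
Hypothesis k1 : forall x, k x setT = 1%E.

Lemma probability_kernel_exists :
  exists k' : R.-pker T ~> T', forall x, k' x = k x.
Proof.
pose k_isKernel := isKernel.Build _ _ _ _ _ k mk.
pose kk : R.-ker T ~> T' := HB.pack k k_isKernel.
pose k_isProb := Kernel_isProbability.Build _ _ _ _ _ kk k1.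
pose k' : R.-pker T ~> T' := HB.pack k k_isKernel k_isProb.
by exists k'.
Qed.

End make_probability_kernel.

Section bayes.
Local Open Scope ereal_scope.
Context {R : realType} {X Y : completeNormedModType R} (z : nat -> X).
Variables (mu0 : probability (borel X) R) (Q0 : probability (borel Y) R).
Variable Phi : X -> Y -> R.
Hypothesis mu0_supp : mu0 (~` closure (range z)) = 0.
Hypothesis Phi_meas : forall u, measurable_fun setT (Phi u : borel Y -> R).
Hypothesis Phi_cont : forall y, continuous (Phi ^~ y).
Hypothesis evidence_lty : forall y, evidence mu0 Phi y < +oo.

Let S : set (borel X) := closure (range z).
Let L (u : borel X) (y : borel Y) : R := expR (- Phi u y).

Let mS : measurable S.
Proof. by apply: closed_measurable_borel; exact: closed_closure. Qed.

Let L_cont y : continuous (L ^~ y : X -> R).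
Proof.
move=> u; apply: (continuous_comp (f := fun u => - Phi u y)%R); last exact: continuous_expR.
by apply: continuousN; exact: Phi_cont.
Qed.

Let mLy y : measurable_fun setT (L ^~ y).
Proof. by apply: continuous_measurable_borel; exact: L_cont. Qed.

Let mLu u : measurable_fun setT (L u).
Proof.
apply: measurableT_comp; first exact: measurable_expR.
by apply: measurable_funN; exact: Phi_meas.
Qed.

Let L_ge0 u y : (0 <= L u y)%R. Proof. exact: expR_ge0. Qed.

(** Joint measurability of the likelihood is available over [S]; truncation to a rectangle over a
    subset of [S] makes a globally measurable function for Tonelli. *)
Let LX (C : set (borel X * borel Y)) p : \bar R :=
  ((fun p => (L p.1 p.2)%:E) \_ C) p.

Let LX_ge0 C p : 0 <= LX C p.
Proof. by apply: erestrict_ge0 => q _; rewrite lee_fin. Qed.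

Let mLX A B : measurable A -> measurable B -> A `<=` S ->
  measurable_fun setT (LX (A `*` B)).
Proof.
move=> mA mB AS; apply/(measurable_restrictT _ _).1; first exact: measurableX.
apply/measurable_EFinP.
apply: measurable_funS (measurable_caratheodory (F := L) (z := z) mLu L_cont).
- exact: measurableX.
- by move=> p [/= /AS].
Qed.

Lemma L_integral_supp A y : measurable A ->
  \int[mu0]_(u in A) (L u y)%:E = \int[mu0]_u (LX ((A `&` S) `*` setT) (u, y)).
Proof.
move=> mA.
rewrite (@ge0_negligible_integral _ _ _ mu0 A (~` S))//; first last.
- by move=> u _; rewrite lee_fin.
- by apply: measurable_funTS; exact/measurable_EFinP.
- exact: measurableC.
rewrite setDE setCK integral_mkcond; apply: eq_integral => u _.
rewrite /LX !patchE; congr (if _ then _ else _).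
apply/idP/idP; rewrite !inE; first by [].
by move=> -[].
Qed.

Lemma measurable_L_integral A : measurable A ->
  measurable_fun setT (fun y => \int[mu0]_(u in A) (L u y)%:E).
Proof.
move=> mA.
rewrite (_ : (fun y => _) =
    (fun y => \int[mu0]_u (LX ((A `&` S) `*` setT) (u, y)))); last first.
  by apply/funext => y; exact: L_integral_supp.
apply: (measurable_fun_fubini_tonelli_G (m1 := mu0) (LX ((A `&` S) `*` setT))) => //.
by apply: mLX => //; exact: measurableI.
Qed.

(** A nonnegative function with zero integral vanishes almost everywhere; the exponential never
    does, so the whole space would be null. *)
Lemma evidence_gt0 y : 0 < evidence mu0 Phi y.
Proof.
rewrite lt_neqAle integral_ge0 ?andbT; last by move=> u _; rewrite lee_fin expR_ge0.
apply/eqP => /esym Z0.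
have : ae_eq mu0 setT (fun u => (L u y)%:E) (cst 0).
  apply/ae_eq_integral_abs => //; first exact/measurable_EFinP.
  rewrite -[RHS]Z0; apply: eq_integral => u _.
  by rewrite gee0_abs// lee_fin.
move=> [N [mN N0 /(_ _) LN]].
have : mu0 setT = 0.
  apply: subset_measure0 N0 => //; move=> u _; apply: LN => /= /(_ I)[] /eqP.
  by rewrite gt_eqF// expR_gt0.
by rewrite probability_setT => /eqP; rewrite onee_eq0.
Qed.

Let Z (y : borel Y) := fine (evidence mu0 Phi y).

Let EZ y : evidence mu0 Phi y = (Z y)%:E.
Proof. by rewrite fineK// ge0_fin_numE// ltW// evidence_gt0. Qed.

Let Z_gt0 y : (0 < Z y)%R.
Proof. by rewrite -lte_fin -EZ evidence_gt0. Qed.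

Let mZ : measurable_fun setT Z.
Proof.
apply/measurable_EFinP; rewrite (_ : _ \o _ = fun y => \int[mu0]_(u in setT) (L u y)%:E).
  exact: measurable_L_integral.
by apply/funext => y /=; rewrite -EZ.
Qed.

Let mpost y : measurable_fun setT (fun u => (Z y)^-1 * L u y)%R.
Proof. exact: measurable_funM. Qed.

Let post_ge0 y u : (0 <= (Z y)^-1 * L u y)%R.
Proof. by rewrite mulr_ge0// invr_ge0 ltW. Qed.

Definition posterior (y : borel Y) : {measure set (borel X) -> \bar R} :=
  density_measure mu0 (mpost y) (post_ge0 y).

Let posteriorE y A : measurable A ->
  posterior y A = ((Z y)^-1)%:E * \int[mu0]_(u in A) (L u y)%:E.
Proof.
move=> mA.
rewrite (_ : posterior y A = \int[mu0]_(u in A) (((Z y)^-1)%:E * (L u y)%:E))//.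
rewrite ge0_integralZl//.
- by apply: measurable_funTS; exact/measurable_EFinP.
- by move=> u _; rewrite lee_fin.
- by rewrite lee_fin invr_ge0 ltW.
Qed.

Let measurable_posterior A : measurable A -> measurable_fun setT (posterior ^~ A).
Proof.
move=> mA.
rewrite (_ : posterior ^~ A =
    fun y => ((Z y)^-1)%:E * \int[mu0]_(u in A) (L u y)%:E); last first.
  by apply/funext => y; exact: posteriorE.
apply: emeasurable_funM; last exact: measurable_L_integral.
(* Inversion is rewritten as the power -1, a measurable function; the two agree where [Z] is
   positive, that is, everywhere. *)
have mZV : measurable_fun setT (fun y => (Z y)^-1)%R.
  rewrite (_ : (fun y => _) = (@powR R ^~ (-1)%R) \o Z).
    by apply: measurableT_comp => //; exact: measurable_powR.
  by apply/funext => y /=; rewrite powR_inv1// ltW.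
exact/measurable_EFinP.
Qed.

Let posterior_setT y : posterior y setT = 1.
Proof.
rewrite posteriorE// -[X in _ * X]/(evidence mu0 Phi y) EZ -EFinM mulVf//.
by rewrite gt_eqF.
Qed.

Lemma bayes_formula_posterior (m : {measure set (borel X) -> \bar R}) y :
  (forall A, measurable A -> m A = posterior y A) -> bayes_formula mu0 Phi y m.
Proof.
move=> mE; split; last first.
  by split => [|A mA]; [exact: mpost|rewrite mE].
apply/null_content_dominatesP => A mA A0.
rewrite mE// posteriorE// null_set_integral ?mule0//.
by apply: measurable_funTS; exact/measurable_EFinP.
Qed.

Variables (Q : X -> set (borel Y) -> \bar R).
Hypothesis Q_density : forall u, has_density Q0 (L u) (Q u).
Hypothesis Q_setT : forall u, Q u setT = 1.
Variable joint : probability (borel X * borel Y)%type R.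
Hypothesis jointP : joint_law mu0 Q joint.
(** The marginal law of [y] as a bundled measure, tied by [nuE] to the bare set function that
    appears in [conditional_law]. *)
Variable nu : {measure set (borel Y) -> \bar R}.
Hypothesis nuE : nu = pushforward joint snd :> (set (borel Y) -> \bar R).

Lemma joint_evidence A B : measurable A -> measurable B ->
  joint (A `*` B) = \int[Q0]_(y in B) \int[mu0]_(u in A) (L u y)%:E.
Proof.
move=> mA mB.
have mAS : measurable (A `&` S) by exact: measurableI.
have mAD : measurable (A `\` S) by exact: measurableD.
(* [u |-> Q u B] is only known to be measurable on [S], so the part of [A] off
   [S] is discarded through [joint] and not inside the integral *)
transitivity (joint ((A `&` S) `*` B)).
  have -> : A `*` B = (A `&` S) `*` B `|` (A `\` S) `*` B.
    apply/seteqP; split => [[u y] [/= Au By]|[u y] [] [/= []]//].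
    by have [Su|Su] := pselect (S u); [left|right].
  rewrite measureU; [|exact: measurableX..|]; last first.
    by apply/seteqP; split => // -[u y] [[/= [_ Su] _] [/= [_ /(_ Su)]]].
  rewrite [X in _ + X](_ : _ = 0) ?adde0//.
  (* The piece is enlarged to a full strip, where the inner mass is the constant 1 and the joint
     mass is just [mu0 (A \ S) = 0]. *)
  apply: (@subset_measure0 _ _ _ joint _ ((A `\` S) `*` setT)).
  - exact: measurableX.
  - exact: measurableX.
  - by move=> p [].
  - apply: (etrans (jointP mAD measurableT)).
    under eq_integral do rewrite Q_setT.
    rewrite integral_cst// mul1e.
    apply: (subset_measure0 (mu := mu0) mAD _ _ mu0_supp) => [|u []//].
    exact: measurableC.
rewrite jointP//.
transitivity (\int[mu0]_u \int[Q0]_y (LX ((A `&` S) `*` B) (u, y))).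
  rewrite integral_mkcond; apply: eq_integral => u _.
  rewrite patchE; case: ifPn => uAS.
    have [_ ->//] := Q_density u.
    rewrite integral_mkcond; apply: eq_integral => y _.
    rewrite /LX !patchE; congr (if _ then _ else _).
    apply/idP/idP; rewrite !inE; first by move=> By; split => //; exact/set_mem.
    by case.
  rewrite integral0_eq// => y _; rewrite /LX patchE ifF//.
  by apply/negbTE; apply: contra uAS; rewrite !inE => -[].
rewrite (fubini_tonelli (LX ((A `&` S) `*` B)))//; last by apply: mLX => // ? [].
rewrite [RHS]integral_mkcond; apply: eq_integral => y _.
rewrite patchE; case: ifPn => yB.
  rewrite L_integral_supp//; apply: eq_integral => u _.
  rewrite /LX !patchE; congr (if _ then _ else _).
  apply/idP/idP; rewrite !inE; first by case.
  by move=> [uAS _]; split => //; exact/set_mem.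
rewrite integral0_eq// => u _; rewrite /LX patchE ifF//.
by apply/negbTE; apply: contra yB; rewrite !inE => -[].
Qed.

Lemma marginal_density : has_density Q0 Z nu.
Proof.
split => // B mB; rewrite nuE /pushforward.
rewrite (_ : snd @^-1` B = setT `*` B); last first.
  by apply/seteqP; split => // -[u y] [].
rewrite joint_evidence//; apply: eq_integral => y _.
by rewrite -EZ.
Qed.

(** The density [Z] of the marginal cancels the normalising factor of the posterior, which leaves
    the Tonelli formula of [joint_evidence]. *)
Lemma conditional_law_posterior A B : measurable A -> measurable B ->
  joint (A `*` B) = \int[nu]_(y in B) posterior y A.
Proof.
move=> mA mB.
rewrite (ge0_integral_density (fun y => ltW (Z_gt0 y)) marginal_density)//; last first.
  by apply: measurable_funTS; exact: measurable_posterior.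
rewrite joint_evidence//; apply: eq_integral => y _.
rewrite posteriorE// muleC muleA -EFinM divff ?mul1e//.
by rewrite gt_eqF.
Qed.

Theorem bayes_posterior_exists :
  exists mu : R.-pker (borel Y) ~> (borel X),
    conditional_law joint mu /\ forall y : Y, bayes_formula mu0 Phi y (mu y).
Proof.
have [mu muE] := probability_kernel_exists measurable_posterior posterior_setT.
exists mu; split => [A B mA mB|y].
  rewrite conditional_law_posterior// -nuE; apply: eq_integral => y _.
  by rewrite muE.
by apply: bayes_formula_posterior => A mA; rewrite muE.
Qed.

Theorem bayes_posterior_unique (mu : R.-pker (borel Y) ~> (borel X)) :
  conditional_law joint mu ->
  {ae pushforward joint snd, forall y : borel Y, bayes_formula mu0 Phi y (mu y)}.
Proof.
move=> mu_cond; rewrite -nuE.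
have nuT : nu setT = 1 by rewrite nuE /pushforward preimage_setT probability_setT.
have aeE A : measurable A -> {ae nu, forall y, mu y A = posterior y A}.
  move=> mA.
  have : ae_eq nu setT (mu ^~ A) (posterior ^~ A).
    (* Equal integrals over all measurable sets force equality almost everywhere; the required
       integrability holds because a probability kernel is bounded by 1. *)
    apply: integral_ae_eq => //; last 2 first.
    - exact: measurable_posterior.
    - move=> B _ mB; rewrite -conditional_law_posterior// mu_cond//.
      by rewrite nuE.
    apply/integrableP; split; first exact: measurable_kernel.
    apply: (@le_lt_trans _ _ (\int[nu]_y (cst 1) y)).
      apply: ge0_le_integral => //.
      - apply: measurableT_comp => //; exact: measurable_kernel.
      - move=> y _; rewrite gee0_abs//= -(prob_kernel (s := mu) y).
        by apply: le_measure; rewrite ?inE.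
    by rewrite integral_cst// mul1e nuT ltry.
  by apply: filterS => y /= /(_ I).
have := aeE _ (measurableC mS).
(* The pi-system is enumerated by natural numbers, so its exceptional null sets merge into one;
   numbers that code no sequence stand for the empty one. *)
have : {ae nu, forall y, forall n, let s := odflt [::] (unpickle n) in
    mu y (base_inter z s) = posterior y (base_inter z s)}.
  by apply: ae_foralln => n; apply: aeE; exact: measurable_base_inter.
apply: filterS2 => y mu_base mu_supp; apply: bayes_formula_posterior.
have post_supp : posterior y (~` S) = 0.
  rewrite posteriorE; last exact: measurableC.
  rewrite null_set_integral ?mule0//; first exact: measurableC.
  by apply: measurable_funTS; exact/measurable_EFinP.
apply: (measure_eq_base_inter (z := z)) => //.
- by rewrite prob_kernel ltry.
- by rewrite -post_supp.
- by move=> s; have := mu_base (pickle s); rewrite pickleK.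
Qed.

End bayes.

(** * Wavelet series as generalised functions *)

Section L2.
Context {R : realType} {d : nat}.
Implicit Types (f g : 'rV[R]_d -> R) (D : set (d.-tuple (measurableTypeR R))).

Lemma measurable_torus : measurable (@torus R d).
Proof.
rewrite (_ : @torus R d = \bigcap_(i in [set: 'I_d]) ((@tnth d (measurableTypeR R))^~ i @^-1` `]0, 1]%classic)).
  apply: fin_bigcap_measurable => [|i _]; first exact: finite_finset.
  rewrite -[X in measurable X]setTI.
  exact: (measurable_tnth (T := measurableTypeR R) i measurableT (measurable_itv _)).
apply/seteqP; split => [x x01 i _|x x01 i]; first by rewrite /= in_itv/=.
by have := x01 i I; rewrite /= in_itv/=.
Qed.

(** The product is dominated through [|a b| <= a^2 + b^2]. *)
Lemma integrable_square_integrableM D f g : measurable D ->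
  square_integrable D f -> square_integrable D g ->
  (@lebesgue_tuple R d).-integrable D (EFin \o (fun x => f (vec x) * g (vec x))).
Proof.
move=> mD [mf f2] [mg g2].
have mf2 : measurable_fun D (fun x => f (vec x) ^+ 2) by exact: measurable_funX.
have mg2 : measurable_fun D (fun x => g (vec x) ^+ 2) by exact: measurable_funX.
apply/integrableP; split; first by apply/measurable_EFinP; exact: measurable_funM.
apply: (@le_lt_trans _ _ (\int[@lebesgue_tuple R d]_(x in D)
    ((f (vec x) ^+ 2)%:E + (g (vec x) ^+ 2)%:E))%E).
  apply: ge0_le_integral => //.
  - apply: measurableT_comp => //; apply/measurable_EFinP; exact: measurable_funM.
  - by apply: emeasurable_funD; exact/measurable_EFinP.
  - move=> x _ /=; rewrite lee_fin normrM -(real_normK (num_real (f _))) -(real_normK (num_real (g _))).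
    set a := `|f _|; set b := `|g _|.
    rewrite -subr_ge0; have -> : a ^+ 2 + b ^+ 2 - a * b = (a - b) ^+ 2 + a * b.
      by rewrite sqrrB; ring.
    by apply: addr_ge0; [exact: sqr_ge0|apply: mulr_ge0; exact: normr_ge0].
rewrite ge0_integralD//; last 4 first.
- by move=> x _; rewrite lee_fin sqr_ge0.
- exact/measurable_EFinP.
- by move=> x _; rewrite lee_fin sqr_ge0.
- exact/measurable_EFinP.
by rewrite lte_add_pinfty.
Qed.

End L2.

Section wavelet_series.
Context {R : realType} {d : nat} (psi : nat -> 'rV[R]_d -> R).
Hypothesis psi_basis : @orthonormal_basis R d (@torus R d) nat psi.

Lemma inner_span k (n : nat) (a : nat -> R) :
  inner (@torus R d) (psi k) (fun x => \sum_(l < n) a l * psi l x) =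
  if (k < n)%N then a k else 0.
Proof.
have [psi2 psio _] := psi_basis.
have mT := @measurable_torus R d.
pose h n x := \sum_(l < n) a l * psi l (vec x).
(* Integrability is carried through the induction together with the value, since additivity of the
   real integral requires it. *)
suff [] : (@lebesgue_tuple R d).-integrable (@torus R d) (EFin \o (fun x => psi k (vec x) * h n x)) /\
  \int[@lebesgue_tuple R d]_(x in @torus R d) (psi k (vec x) * h n x) =
    if (k < n)%N then a k else 0 by [].
elim: n => [|n [ih1 ih2]].
  rewrite /h; under [X in EFin \o X]eq_fun do rewrite big_ord0 mulr0.
  under eq_Rintegral do rewrite big_ord0 mulr0.
  split; first exact: integrable0.
  by rewrite Rintegral_cst// mul0r.
have hS x : psi k (vec x) * h n.+1 x =
    psi k (vec x) * h n x + a n * (psi k (vec x) * psi n (vec x)).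
  by rewrite /h big_ord_recr/=; ring.
have int1 := integrable_square_integrableM mT (psi2 k) (psi2 n).
have int2 : (@lebesgue_tuple R d).-integrable (@torus R d)
    (EFin \o (fun x => a n * (psi k (vec x) * psi n (vec x)))).
  exact: (integrableZl mT (a n) int1).
split.
  rewrite (_ : EFin \o _ = (EFin \o (fun x => psi k (vec x) * h n x)) \+
      (EFin \o (fun x => a n * (psi k (vec x) * psi n (vec x))))).
    exact: integrableD.
  by apply/funext => x /=; rewrite hS.
rewrite (@eq_Rintegral _ _ _ _ _ (fun x => psi k (vec x) * h n x + a n * (psi k (vec x) * psi n (vec x)))); last first.
  by move=> x _; rewrite hS.
rewrite RintegralD// ih2 RintegralZl//.
have -> : \int[@lebesgue_tuple R d]_(x in @torus R d) (psi k (vec x) * psi n (vec x)) = (k == n)%:R.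
  exact: psio.
rewrite ltnS [(k <= n)%N]leq_eqVlt; case: eqVneq => [->|kn] /=.
  by rewrite ltnn add0r mulr1.
by rewrite mulr0 addr0.
Qed.

(** By orthonormality the partial sums are constant from index [n] on, so the limit is a finite sum
    for any coefficients [c]. *)
Lemma wavelet_series_span (c a : nat -> R) n :
  wavelet_series psi c (fun x => \sum_(l < n) a l * psi l x) =
  \sum_(l < n) c l * a l.
Proof.
rewrite /wavelet_series asboolT; last by exists n, a.
apply/lim_near_cst => //; exists n => // m /= nm.
rewrite /series/=; under eq_bigr do rewrite inner_span.
rewrite (@big_cat_nat _ _ _ n)//= [X in _ + X]big_nat_cond [X in _ + X]big1 ?addr0.
  rewrite big_mkord; apply: eq_bigr => i _; by rewrite ltn_ord.
by move=> i /andP[/andP[ni _] _]; rewrite ltnNge ni mulr0.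
Qed.

Lemma wavelet_series_psi (c : nat -> R) l : wavelet_series psi c (psi l) = c l.
Proof.
have {1}-> : psi l = fun x => \sum_(i < l.+1) (nat_of_ord i == l)%:R * psi i x.
  apply/funext => x; rewrite big_ord_recr/= eqxx mul1r big1 ?add0r// => i _.
  by rewrite ltn_eqF// mul0r.
rewrite (wavelet_series_span c (fun i => (i == l)%:R)).
rewrite big_ord_recr/= eqxx mulr1 big1 ?add0r// => i _.
by rewrite ltn_eqF// mulr0.
Qed.

(** Padding the coefficients with zeros allows any larger number of terms, so that two test
    functions can be written with a common length. *)
Lemma wavelet_spanP (h : 'rV[R]_d -> R) : wavelet_span psi h ->
  exists (n : nat) (a : nat -> R), forall N, (n <= N)%N -> h = fun x => \sum_(l < N) a l * psi l x.
Proof.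
move=> [n [a ->]]; exists n, (fun l => if (l < n)%N then a l else 0) => N nN.
apply/funext => x; rewrite -(big_mkord xpredT (fun l => a l * psi l x)).
rewrite -(big_mkord xpredT (fun l => (if (l < n)%N then a l else 0) * psi l x)).
rewrite [RHS](@big_cat_nat _ _ _ n)//= [X in _ + X]big_nat_cond [X in _ + X]big1 ?addr0.
  by apply: eq_big_nat => i /andP[_ ->].
by move=> i /andP[/andP[ni _] _]; rewrite ltnNge ni mul0r.
Qed.

Lemma wavelet_span_lin (a : R) (g h : 'rV[R]_d -> R) :
  wavelet_span psi g -> wavelet_span psi h ->
  exists (n : nat) (b b' : nat -> R), [/\ g = fun x => \sum_(l < n) b l * psi l x,
    h = fun x => \sum_(l < n) b' l * psi l x &
    (fun x => a * g x + h x) = fun x => \sum_(l < n) (a * b l + b' l) * psi l x].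
Proof.
move=> /wavelet_spanP[n [b gE]] /wavelet_spanP[m [b' hE]].
exists (maxn n m), b, b'; split; [exact/gE/leq_maxl|exact/hE/leq_maxr|].
apply/funext => x; rewrite (gE _ (leq_maxl n m)) (hE _ (leq_maxr n m)).
by rewrite mulr_sumr -big_split/=; apply: eq_bigr => i _; ring.
Qed.

Lemma generalized_function_wavelet_series (c : nat -> R) :
  generalized_function psi (wavelet_series psi c).
Proof.
split => [a g h gs hs|h nh]; last by rewrite /wavelet_series asboolF.
have [n [b [b' [-> -> ghE]]]] := wavelet_span_lin a gs hs.
rewrite [X in wavelet_series _ _ X = _](_ : _ =
  fun x => \sum_(l < n) (a * b l + b' l) * psi l x).
  rewrite !wavelet_series_span (wavelet_series_span c (fun l => a * b l + b' l)).
  by rewrite mulr_sumr -big_split/=; apply: eq_bigr => i _; ring.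
apply/funext => x; rewrite mulr_sumr -big_split/=.
by apply: eq_bigr => i _; ring.
Qed.

Lemma wavelet_seriesD (a : R) (c c' : nat -> R) :
  (fun h => a * wavelet_series psi c h + wavelet_series psi c' h) =
  wavelet_series psi (fun l => a * c l + c' l).
Proof.
apply/funext => h; have [[n [b ->]]|nh] := pselect (wavelet_span psi h).
  rewrite !wavelet_series_span mulr_sumr -big_split/=.
  by apply: eq_bigr => i _; ring.
by rewrite /wavelet_series asboolF// mulr0 addr0.
Qed.

Lemma holder_norm_wavelet_series_le (t B : R) (c : nat -> R) :
  (forall l, l.+1%:R `^ (t / d%:R + 2^-1) * `|c l| <= B) ->
  (holder_norm psi t (wavelet_series psi c) <= B%:E)%E.
Proof.
move=> cB; apply: ge_ereal_sup => _ [l _ <-].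
by rewrite wavelet_series_psi lee_fin.
Qed.

Lemma holder_norm_ge0 (t : R) f : (0 <= holder_norm psi t f)%E.
Proof.
apply: (@le_trans _ _ (1%:R `^ (t / d%:R + 2^-1) * `|f (psi 0%N)|)%:E).
  by rewrite lee_fin mulr_ge0// powR_ge0.
by apply: ereal_sup_ubound; exists 0%N.
Qed.

Section embedding.
Context (X : normedModType R) (t : R).
Variables (iota : (('rV[R]_d -> R) -> R) -> X) (ce : R).
Hypothesis iota_embedding : continuous_embedding psi t iota ce.

(** The constant [ce] comes without a sign; its positive part makes the bound monotone in the norm,
    so that [B] may replace the norm. *)
Lemma embedding_series_bound (B : R) (c : nat -> R) :
  (forall l, l.+1%:R `^ (t / d%:R + 2^-1) * `|c l| <= B) ->
  `|iota (wavelet_series psi c)| <= Num.max ce 0 * B.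
Proof.
have [_ _ iota_le] := iota_embedding.
move=> /holder_norm_wavelet_series_le cB.
have hs : holder_space psi t (wavelet_series psi c).
  split; first exact: generalized_function_wavelet_series.
  exact: le_lt_trans cB (ltry _).
apply: (le_trans (iota_le _ hs)).
have n0 := holder_norm_ge0 t (wavelet_series psi c).
have nB : fine (holder_norm psi t (wavelet_series psi c)) <= B.
  by rewrite -lee_fin fineK// ge0_fin_numE// (le_lt_trans cB)// ltry.
apply: (@le_trans _ _ (Num.max ce 0 * fine (holder_norm psi t (wavelet_series psi c)))).
  by rewrite ler_wpM2r ?fine_ge0// le_max lexx.
by rewrite ler_wpM2l// le_max lexx orbT.
Qed.

(** Linearity of [iota] holds on the Holder space only; the two bounds place both series there. *)
Lemma embedding_seriesB (B B' : R) (c c' : nat -> R) :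
  (forall l, l.+1%:R `^ (t / d%:R + 2^-1) * `|c l| <= B) ->
  (forall l, l.+1%:R `^ (t / d%:R + 2^-1) * `|c' l| <= B') ->
  iota (wavelet_series psi c) - iota (wavelet_series psi c') =
  iota (wavelet_series psi (fun l => c l - c' l)).
Proof.
have [iota_lin _ _] := iota_embedding.
move=> /holder_norm_wavelet_series_le cB /holder_norm_wavelet_series_le cB'.
rewrite addrC -scaleN1r -iota_lin; first last.
- split; first exact: generalized_function_wavelet_series.
  exact: le_lt_trans cB (ltry _).
- split; first exact: generalized_function_wavelet_series.
  exact: le_lt_trans cB' (ltry _).
rewrite wavelet_seriesD; congr (iota (wavelet_series psi _)).
by apply/funext => l; rewrite mulN1r addrC.
Qed.

End embedding.

End wavelet_series.

(** * Draws from the prior, and a countable family dense among them *)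

Section prior_series.
Context {R : realType} {d : nat} (psi : nat -> 'rV[R]_d -> R).
Hypothesis psi_basis : @orthonormal_basis R d (@torus R d) nat psi.
Context (X : normedModType R) (s t q kappa : R).
Variables (iota : (('rV[R]_d -> R) -> R) -> X) (ce : R).
Hypothesis iota_embedding : continuous_embedding psi t iota ce.

Let gamma := (s - t) / d%:R - q^-1.
Let cq : R := kappa^-1 `^ q^-1.

Definition prior_series (x : nat -> R) : X :=
  iota (wavelet_series psi (fun l => prior_coefficient d s q kappa l * x l)).

(** The exponents [t/d + 1/2] and [-(s/d + 1/2 - 1/q)] add up to [-gamma]. *)
Lemma prior_coefficient_holder l x :
  l.+1%:R `^ (t / d%:R + 2^-1) * `|prior_coefficient d s q kappa l * x| =
  cq * (l.+1%:R `^ (- gamma) * `|x|).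
Proof.
rewrite /prior_coefficient !normrM (ger0_norm (powR_ge0 l.+1%:R _)).
rewrite (ger0_norm (powR_ge0 kappa^-1 _)).
have -> : - gamma = t / d%:R + 2^-1 + - (s / d%:R + 2^-1 - q^-1).
  by rewrite /gamma; ring.
by rewrite [in RHS]powRD ?pnatr_eq0 ?implybT// /cq; ring.
Qed.

Lemma prior_coefficient_holder_le B x :
  (forall l : nat, l.+1%:R `^ (- gamma) * `|x l| <= B) -> forall l : nat,
  l.+1%:R `^ (t / d%:R + 2^-1) * `|prior_coefficient d s q kappa l * x l| <= cq * B.
Proof.
by move=> xB l; rewrite prior_coefficient_holder ler_wpM2l// powR_ge0.
Qed.

Lemma prior_series_le B x :
  (forall l : nat, l.+1%:R `^ (- gamma) * `|x l| <= B) ->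
  `|prior_series x| <= Num.max ce 0 * (cq * B).
Proof.
by move=> /prior_coefficient_holder_le; exact: embedding_series_bound.
Qed.

Lemma prior_seriesB B B' x x' :
  (forall l : nat, l.+1%:R `^ (- gamma) * `|x l| <= B) ->
  (forall l : nat, l.+1%:R `^ (- gamma) * `|x' l| <= B') ->
  prior_series x - prior_series x' = prior_series (fun l => x l - x' l).
Proof.
move=> /prior_coefficient_holder_le xB /prior_coefficient_holder_le xB'.
rewrite /prior_series (embedding_seriesB psi_basis iota_embedding xB xB').
by congr (iota (wavelet_series psi _)); apply/funext => l; rewrite mulrBr.
Qed.

(** Finite rational coefficient sequences, coded by natural numbers and continued by 0. *)
Definition rational_prior_series (k : nat) : X :=
  prior_series (fun l => ratr (nth 0 (odflt [::] (unpickle k : option (seq rat))) l)).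

(** A bound with weight [gamma / 2] forces decay with weight [gamma]: the tail is cut off, and the
    finitely many remaining coefficients are rounded to rationals. *)
Lemma prior_series_closure C x : 0 < gamma ->
  (forall l : nat, l.+1%:R `^ (- (gamma / 2)) * `|x l| <= C) ->
  closure (range rational_prior_series) (prior_series x).
Proof.
move=> gamma0 xC U /nbhs_ballP[e /= e0 eU].
have C0 : 0 <= C by apply: le_trans (xC 0%N); rewrite mulr_ge0// powR_ge0.
pose K := Num.max ce 0 * cq.
have K0 : 0 <= K by rewrite mulr_ge0 ?powR_ge0// le_max lexx orbT.
(* The summand 1 avoids division by zero and makes [K * e' < e] strict. *)
pose e' := e / (K + 1).
have e'0 : 0 < e' by rewrite divr_gt0// ltr_wpDl.
have pow1 (l : nat) b : 0 <= b -> l.+1%:R `^ (- b) <= 1 :> R.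
  by move=> b0; rewrite -[leRHS](powRr0 l.+1%:R) ler_powR ?ler1n// oppr_le0.
have [N Nx] : exists N : nat, forall l : nat, (N <= l)%N ->
    l.+1%:R `^ (- gamma) * `|x l| <= e'.
  (* Solves [(l+1)^(- gamma/2) * C <= e'] for [l]. *)
  pose N := Num.truncn ((C / e') `^ (2 / gamma)).
  exists N.+1 => l Nl.
  have -> : - gamma = - (gamma / 2) + - (gamma / 2) by field.
  rewrite powRD ?pnatr_eq0 ?implybT// -mulrA.
  apply: (@le_trans _ _ (l.+1%:R `^ (- (gamma / 2)) * C)).
    by rewrite ler_wpM2l// powR_ge0.
  rewrite powRN mulrC ler_pdivrMr ?powR_gt0// mulrC -ler_pdivrMr//.
  have -> : C / e' = ((C / e') `^ (2 / gamma)) `^ (gamma / 2).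
    rewrite -powRrM (_ : 2 / gamma * (gamma / 2) = 1); first by rewrite powRr1// divr_ge0// ltW.
    by field; rewrite gt_eqF.
  apply: ge0_ler_powR.
  - by rewrite divr_ge0// ltW.
  - by rewrite nnegrE powR_ge0.
  - by rewrite nnegrE.
  - apply/ltW/(lt_le_trans (truncnS_gt _)); rewrite ler_nat.
    exact: leq_trans Nl (leqnSn _).
have /choice[r rx] : forall l, exists r : rat, `|x l - ratr r| <= e'.
  move=> l; have [|r] := @rat_in_itvoo R (x l - e') (x l + e').
    by rewrite ltrD2l gt0_cp.
  rewrite in_itv/= => /andP[r1 r2]; exists r.
  by rewrite ler_norml; apply/andP; split; lra.
pose y l : R := ratr (nth 0 (mkseq r N) l).
have yx l : l.+1%:R `^ (- gamma) * `|x l - y l| <= e'.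
  rewrite /y; have [lN|Nl] := ltnP l N.
    rewrite nth_mkseq//; apply: le_trans (rx l).
    by rewrite ler_piMl// pow1// ltW.
  by rewrite nth_default ?size_mkseq// raddf0 subr0 Nx.
have xC' l : l.+1%:R `^ (- gamma) * `|x l| <= C.
  apply: le_trans (xC l); rewrite ler_wpM2r// ler_powR ?ler1n//.
  by rewrite lerN2 ler_pdivrMr// ler_peMr ?ler1n// ltW.
(* This crude bound serves to place the series of [y] in the Holder space, as [prior_seriesB]
   requires. *)
have yB l : l.+1%:R `^ (- gamma) * `|y l| <= C + e'.
  have -> : y l = x l - (x l - y l) by ring.
  apply: (@le_trans _ _ (l.+1%:R `^ (- gamma) * (`|x l| + `|x l - y l|))).
    by rewrite ler_wpM2l ?powR_ge0// ler_normB.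
  by rewrite mulrDr lerD.
exists (prior_series y); split.
  by exists (pickle (mkseq r N)) => //; rewrite /rational_prior_series pickleK.
apply: eU; rewrite -ball_normE/= (prior_seriesB xC' yB).
apply: (le_lt_trans (prior_series_le yx)).
rewrite mulrA -/K /e' mulrA ltr_pdivrMr ?ltr_wpDl// mulrC mulrDr mulr1.
by rewrite ltrDl.
Qed.

End prior_series.

(** * Exponential moments of the prior *)

Section stretched_exponential.
Context {R : realType}.
Implicit Types (b c g p y : R).

Lemma expR_weighted_le b p g y (l : nat) : 0 < b -> b < p -> 0 <= g -> 0 <= y ->
  expR (b * (l.+1%:R `^ (- g) * y)) <=
  expR 1 + expR (- ((p - b) / b * l.+1%:R `^ g)) * expR (p * y).
Proof.
move=> b0 bp g0 y0; have z0 : 0 < l.+1%:R `^ g :> R by rewrite powR_gt0.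
rewrite powRN; set z := _ `^ g in z0 *.
have [h|h] := leP (b * (z^-1 * y)) 1.
  by rewrite (le_trans (y := expR 1)) ?ler_expR// lerDl mulr_ge0 ?expR_ge0.
have z1 : 1 <= z by rewrite -[leLHS](powRr0 l.+1%:R) ler_powR ?ler1n.
rewrite -expRD ler_wpDl ?expR_ge0// ler_expR.
(* From [y >= z / b] and [z >= 1] follows [b y / z <= b y = p y - (p - b) y <= p y - (p - b) z /
   b]. *)
have yz : z / b <= y.
  have : z * 1 < z * (b * (z^-1 * y)) by rewrite ltr_pM2l.
  rewrite mulr1 (_ : z * _ = y * b); last by field; rewrite gt_eqF.
  by move=> /ltW; rewrite ler_pdivrMr.
have h1 : b * (z^-1 * y) <= b * y.
  by rewrite ler_wpM2l ?(ltW b0)// ler_piMl// invf_le1.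
have h2 : (p - b) * (z / b) <= (p - b) * y by rewrite ler_wpM2l// subr_ge0 ltW.
have -> : (p - b) / b * z = (p - b) * (z / b) by field; rewrite gt_eqF.
lra.
Qed.

(** Telescoping: [1 / m^2 <= 2 / m - 2 / (m + 1)] for [m >= 1]. *)
Lemma nneseries_invn2_lty : (\sum_(0 <= l <oo) ((l.+1%:R ^- 2 : R)%:E) < +oo)%E.
Proof.
apply: (@le_lt_trans _ _ 2%:E); last exact: ltry.
apply: lime_le.
  by apply: is_cvg_nneseries => n _ _; rewrite lee_fin invr_ge0 exprn_ge0.
apply: nearW => n; rewrite sumEFin lee_fin.
suff : \sum_(0 <= l < n) l.+1%:R ^- 2 <= 2 - 2 / n.+1%:R :> R.
  by move/le_trans; apply; rewrite gerBl.
elim: n => [|n ih]; first by rewrite big_geq// divr1 subrr.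
rewrite big_nat_recr//=; apply: (le_trans (lerD ih (lexx _))).
rewrite -[n.+2%:R]natr1; set m : R := n.+1%:R.
have m1 : 1 <= m by rewrite ler1n.
have m0 : 0 < m by rewrite ltr0n.
rewrite -subr_ge0 (_ : _ - _ = (m - 1) / (m ^+ 2 * (m + 1))); last first.
  by field; rewrite !gt_eqF// addr_gt0.
by rewrite divr_ge0 ?subr_ge0// mulr_ge0 ?exprn_ge0 ?addr_ge0 ?ltW.
Qed.

Lemma nneseries_expR_powR_lty c g : 0 < c -> 0 < g ->
  (\sum_(0 <= l <oo) (expR (- (c * l.+1%:R `^ g)))%:E < +oo)%E.
Proof.
(* Comparison with [expR K / (l+1)^2]. For [z = (l+1)^g] one has [(l+1)^-2 = exp (- (2/g) ln z)],
   and [ln x <= x - 1] at [x = c g z / 2] gives [- c z <= K - (2/g) ln z]. *)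
move=> c0 g0; pose K := - (2 / g * (1 + ln (c * g / 2))).
have cg0 : 0 < c * g / 2 by rewrite divr_gt0// mulr_gt0.
apply: (@le_lt_trans _ _ (\sum_(0 <= l <oo) ((expR K)%:E * (l.+1%:R ^- 2)%:E))%E).
  apply: lee_nneseries => [l _ _|l _]; first by rewrite lee_fin expR_ge0.
  rewrite -EFinM lee_fin; set z := _ `^ g.
  have l0 : 0 < l.+1%:R :> R by [].
  have z0 : 0 < z by rewrite powR_gt0.
  have -> : l.+1%:R ^- 2 = expR (- (2 / g * ln z)).
    rewrite /z ln_powR expRN -[X in expR X](_ : ln (l.+1%:R ^+ 2) = _) ?lnK ?posrE ?exprn_gt0//.
    by rewrite lnXn// -mulr_natl; field; rewrite gt_eqF.
  clearbody z; rewrite -expRD ler_expR /K -opprD lerN2 -mulrDr.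
  have : ln (c * g / 2 * z) <= c * g / 2 * z - 1.
    rewrite -[X in ln X](subrK 1) [X in ln X]addrC; apply: le_ln1Dx.
    by rewrite ltrBrDl subrr mulr_gt0.
  rewrite lnM ?posrE// => h.
  have : 2 / g * (1 + ln (c * g / 2) + ln z) <= 2 / g * (c * g / 2 * z).
    by rewrite ler_wpM2l ?(divr_ge0 _ (ltW g0))//; lra.
  by rewrite (_ : 2 / g * (c * g / 2 * z) = c * z); last by field; rewrite gt_eqF.
rewrite nneseriesZl; last by move=> l _; rewrite lee_fin invr_ge0 exprn_ge0.
have := nneseries_invn2_lty.
set S := (\sum_(_ <= _ <oo) _)%E => Soo.
have S0 : (0 <= S)%E by apply: nneseries_ge0 => l _ _; rewrite lee_fin invr_ge0 exprn_ge0.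
by rewrite -(fineK (x := S)) ?ge0_fin_numE// -EFinM ltry.
Qed.

End stretched_exponential.

Section exponential_moment.
Context {R : realType} {dO : measure_display} {Omega : measurableType dO}.
Variables (P : probability Omega R) (xi : nat -> {RV P >-> R}).
Variables (b p g D : R).
Hypotheses (b_gt0 : 0 < b) (ltbp : b < p) (g_gt0 : 0 < g).
Hypothesis moment : forall l, (\int[P]_w (expR (p * `|xi l w|))%:E <= D%:E)%E.

(** The sum over [l] of the second terms in [expR_weighted_le]: one variable that controls all
    coefficients at once. *)
Definition exp_series (w : Omega) : \bar R :=
  (\sum_(0 <= l <oo)
    (expR (- ((p - b) / b * l.+1%:R `^ g)) * expR (p * `|xi l w|))%:E)%E.

Let term_ge0 l w :
  (0 <= (expR (- ((p - b) / b * l.+1%:R `^ g)) * expR (p * `|xi l w|))%:E)%E.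
Proof. by rewrite lee_fin mulr_ge0// expR_ge0. Qed.

Let mexp l : measurable_fun setT (fun w => expR (p * `|xi l w|)).
Proof.
apply: measurableT_comp => //; apply: measurable_funM => //.
by apply: measurableT_comp.
Qed.

Let mterm l : measurable_fun setT
  (fun w => (expR (- ((p - b) / b * l.+1%:R `^ g)) * expR (p * `|xi l w|))%:E).
Proof. by apply/measurable_EFinP; exact: measurable_funM. Qed.

Lemma exp_series_ge0 w : (0 <= exp_series w)%E.
Proof. by apply: nneseries_ge0 => l _ _; exact: term_ge0. Qed.

Lemma measurable_exp_series : measurable_fun setT exp_series.
Proof.
apply: ge0_emeasurable_sum => // l w _ _; exact: term_ge0.
Qed.

Lemma exp_series_lty : (\int[P]_w exp_series w < +oo)%E.
Proof.
rewrite integral_nneseries//.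
apply: (@le_lt_trans _ _ (\sum_(0 <= l <oo)
    (D%:E * (expR (- ((p - b) / b * l.+1%:R `^ g)))%:E))%E).
  apply: lee_nneseries => [l _ _|l _]; first exact: integral_ge0.
  under eq_integral do rewrite EFinM.
  rewrite ge0_integralZl//; last exact/measurable_EFinP.
  by rewrite muleC lee_wpmul2r// lee_fin expR_ge0.
rewrite nneseriesZl; last by move=> l _; rewrite lee_fin expR_ge0.
have := @nneseries_expR_powR_lty R ((p - b) / b) g.
rewrite divr_gt0 ?subr_gt0// => /(_ erefl g_gt0).
set S := (\sum_(_ <= _ <oo) _)%E => Soo.
have S0 : (0 <= S)%E by apply: nneseries_ge0 => l _ _; rewrite lee_fin expR_ge0.
by rewrite -(fineK (x := S)) ?ge0_fin_numE// -EFinM ltry.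
Qed.

(** A single term is at most the whole series; the logarithm then gives a bound that does not depend
    on [l]. *)
Lemma exp_series_weighted (w : Omega) (l : nat) : (exp_series w < +oo)%E ->
  l.+1%:R `^ (- g) * `|xi l w| <= ln (expR 1 + fine (exp_series w)) / b.
Proof.
move=> woo; have w_fin : exp_series w \is a fin_num.
  by rewrite ge0_fin_numE// exp_series_ge0.
have w0 : 0 <= fine (exp_series w) by rewrite fine_ge0// exp_series_ge0.
rewrite ler_pdivlMr// mulrC -ler_expR lnK; last first.
  by rewrite posrE ltr_wpDr// expR_gt0.
apply: (le_trans (expR_weighted_le l b_gt0 ltbp (ltW g_gt0) (normr_ge0 _))).
rewrite lerD2l -lee_fin fineK//.
apply: le_trans (nneseries_lim_ge l.+1 _) => [|k _ _]; last exact: term_ge0.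
by rewrite big_nat_recr//= leeDr// sume_ge0.
Qed.

End exponential_moment.

(** * The constant r* *)

Section exponential_integrals.
Context {R : realType}.
Local Notation mu := (@lebesgue_measure R).
Implicit Types (a x : R).

Lemma measurable_expR_scale a : measurable_fun setT (fun x => expR (- (a * x))).
Proof.
apply: measurableT_comp => //; apply: measurable_funN.
by apply: measurable_funM.
Qed.

Lemma integral_expR_itv a : 0 < a ->
  (\int[mu]_(x in `]0%R, +oo[) (expR (- (a * x)))%:E = (a^-1)%:E)%E.
Proof.
move=> a0; rewrite integral_itv_obnd_cbnd; last first.
  by apply/measurable_EFinP; apply: measurable_funTS; exact: measurable_expR_scale.
(* The exponential density [a exp (- a x)] has total mass 1. *)
have := integral_exponential_pdf a0.
have -> : (\int[mu]_x (exponential_pdf a x)%:E =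
    \int[mu]_(x in `[0%R, +oo[) (a%:E * (expR (- (a * x)))%:E))%E.
  rewrite [RHS]integral_mkcond; apply: eq_integral => x _.
  by rewrite /exponential_pdf !patchE; case: ifP => // _; rewrite mulNr EFinM.
have mE : measurable_fun (`[0, +oo[%classic : set R) (fun x => (expR (- (a * x)))%:E).
  by apply/measurable_EFinP; apply: measurable_funTS; exact: measurable_expR_scale.
rewrite ge0_integralZl//; last by rewrite lee_fin ltW.
move=> h.
have : ((a^-1)%:E * (a%:E * \int[mu]_(x in `[0%R, +oo[) (expR (- (a * x)))%:E) = (a^-1)%:E)%E.
  by rewrite h mule1.
by rewrite muleA -EFinM mulVf ?gt_eqF// mul1e.
Qed.

Lemma integral_expR_norm a : 0 < a ->
  (\int[mu]_x (expR (- (a * `|x|)))%:E = (2 / a)%:E)%E.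
Proof.
move=> a0; rewrite ge0_symfun_integralT//.
- rewrite -set_itvcy -integral_itv_obnd_cbnd; last first.
    apply/measurable_EFinP; apply: measurable_funTS; apply: measurableT_comp => //.
    apply: measurable_funN; apply: measurable_funM => //.
  under eq_integral => x.
    rewrite inE/= in_itv/= andbT => x0; rewrite (gtr0_norm x0).
    over.
  by rewrite integral_expR_itv.
- move=> x; apply: (continuous_comp (f := fun x => - (a * `|x|))); last exact: continuous_expR.
  apply: cvgN; apply: cvgM; [exact: cvg_cst|exact: norm_continuous].
- by move=> x /=; rewrite normrN.
Qed.

End exponential_integrals.

(** * Integrals over R^d as iterated integrals *)

Section lebesgue_tuple.
Context {R : realType}.
Local Open Scope ereal_scope.

Lemma ge0_integral_lebesgue_tupleS d
    (f : d.+1.-tuple (measurableTypeR R) -> \bar R) :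
  measurable_fun setT f -> (forall x, 0 <= f x) ->
  \int[lebesgue_tuple d.+1]_x f x =
  \int[@lebesgue_measure R]_x \int[lebesgue_tuple d]_y f (cons_pair (x, y)).
Proof.
move=> mf f0.
transitivity (\int[@lebesgue_measure R \x lebesgue_tuple d]_p f (cons_pair p)).
  rewrite -(@ge0_integral_pushforward _ _ _ _ _ _ (@measurable_cons_pair R d) _ setT)//.
apply: (fubini_tonelli1 (f \o @cons_pair R d)) => [|p]; last exact: f0.
by apply: measurableT_comp => //; exact: measurable_cons_pair.
Qed.

Lemma integral_lebesgue_tuple_prod d (f : R -> R) (I : R) :
  measurable_fun setT f -> (forall x, 0 <= f x)%R ->
  \int[@lebesgue_measure R]_x (f x)%:E = I%:E ->
  \int[lebesgue_tuple d]_x (\prod_(i < d) f (tnth x i))%:E = (I ^+ d)%:E.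
Proof.
move=> mf f0 fI.
have mprod n : measurable_fun setT
    (fun x : n.-tuple (measurableTypeR R) => (\prod_(i < n) f (tnth x i))%R).
  apply: measurable_prod => i _; apply: measurableT_comp => //.
  exact: measurable_tnth.
have prod_ge0 n (x : n.-tuple (measurableTypeR R)) : (0 <= \prod_(i < n) f (tnth x i))%R.
  by apply: prodr_ge0.
elim: d => [|d ih].
  under eq_integral do rewrite big_ord0.
  rewrite integral_cst// mul1e /= diracE expr0.
  by rewrite in_setT.
rewrite ge0_integral_lebesgue_tupleS; last 2 first.
- by apply/measurable_EFinP; exact: mprod.
- by move=> x; rewrite lee_fin; exact: prod_ge0.
transitivity (\int[@lebesgue_measure R]_x ((f x)%:E * (I ^+ d)%:E)).
  apply: eq_integral => x _.
  rewrite -ih -ge0_integralZl//; last 3 first.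
  - by apply/measurable_EFinP; exact: mprod.
  - by move=> y _; rewrite lee_fin; exact: prod_ge0.
  - by rewrite lee_fin.
  apply: eq_integral => y _; rewrite -EFinM big_ord_recl; congr (_ * _)%:E.
  apply: eq_bigr => i _; congr f.
  by rewrite /cons_pair/= !(tnth_nth 0%R)/=.
have I0 : (0 <= I)%R.
  by rewrite -lee_fin -fI integral_ge0// => x _; rewrite lee_fin.
rewrite ge0_integralZr ?fI//.
- by rewrite -EFinM exprS.
- exact/measurable_EFinP.
- by move=> x _; rewrite lee_fin.
- by rewrite lee_fin exprn_ge0.
Qed.

End lebesgue_tuple.

Section norms.
Context {R : realType} (d : nat).
Implicit Type x : 'rV[R]_d.

Lemma enorm_ge0 x : 0 <= enorm x. Proof. exact: sqrtr_ge0. Qed.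

Lemma enorm_le_sum x : enorm x <= \sum_i `|x 0 i|.
Proof.
have s0 : 0 <= \sum_i `|x 0 i| by apply: sumr_ge0.
rewrite -[leRHS]ger0_norm// -sqrtr_sqr ler_wsqrtr// expr2 mulr_suml.
apply: ler_sum => i _; rewrite -(real_normK (num_real (x 0 i))) expr2.
by rewrite ler_wpM2l// (bigD1 i)//= lerDl sumr_ge0.
Qed.

Lemma coord_le_enorm x i : `|x 0 i| <= enorm x.
Proof.
rewrite -sqrtr_sqr ler_wsqrtr// (bigD1 i)//= lerDl sumr_ge0// => j _.
exact: sqr_ge0.
Qed.

Lemma sum_le_enorm x : \sum_i `|x 0 i| <= d%:R * enorm x.
Proof.
apply: (@le_trans _ _ (\sum_(i < d) enorm x)).
  by apply: ler_sum => i _; exact: coord_le_enorm.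
by rewrite sumr_const card_ord mulr_natl.
Qed.

Lemma measurable_enorm_vec :
  measurable_fun setT (fun x : d.-tuple (measurableTypeR R) => enorm (vec x)).
Proof.
have mcoord i : measurable_fun setT (fun x : d.-tuple (measurableTypeR R) => vec x 0 i).
  apply: (eq_measurable_fun (fun x : d.-tuple (measurableTypeR R) => (tnth x i : R))).
    by move=> x _; rewrite mxE.
  exact: measurable_tnth.
apply: (@measurableT_comp _ _ _ _ _ _ (@Num.sqrt R)).
  by apply: continuous_measurable_fun; exact: sqrt_continuous.
by apply: measurable_sum => i; exact: measurable_funX.
Qed.

End norms.

Section constants.
Context {R : realType}.
Local Notation mu := (@lebesgue_measure R).

(** The Euclidean norm is at most the sum norm, and [exp (- sum_i |x_i| / 2)] factorises with
    integral [4^d]. *)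
Lemma c_0_1_ge d : (0 < d)%N -> (4 ^+ d : R) <= c_0 d 1.
Proof.
move=> d0; rewrite /c_0 /Rintegral.
set I := (X in fine X).
have prodE (a : R) (x : d.-tuple (measurableTypeR R)) :
    \prod_(i < d) expR (- (a * `|tnth x i : R|)) = expR (- (a * \sum_i `|vec x 0 i|)).
  rewrite -expR_sum sumrN mulr_sumr; congr (expR (- _)).
  by apply: eq_bigr => i _; rewrite mxE.
have mexp (a : R) : measurable_fun setT (fun x : R => expR (- (a * `|x|))).
  apply: measurableT_comp => //; apply: measurable_funN; apply: measurable_funM => //.
have intE (a : R) : 0 < a -> (\int[lebesgue_tuple d]_x
    (expR (- (a * \sum_i `|vec x 0 i|)))%:E = ((2 / a) ^+ d)%:E)%E.
  move=> a0; rewrite -(integral_lebesgue_tuple_prod d (mexp a) _ (integral_expR_norm a0))//.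
  by apply: eq_integral => x _; rewrite prodE.
have msum (a : R) : measurable_fun setT (fun x : d.-tuple (measurableTypeR R) =>
    (expR (- (a * \sum_i `|vec x 0 i|)))%:E).
  apply/measurable_EFinP; apply: (eq_measurable_fun
    (fun x : d.-tuple (measurableTypeR R) => \prod_(i < d) expR (- (a * `|tnth x i : R|)))).
    by move=> x _; rewrite prodE.
  apply: measurable_prod => i _; apply: (measurableT_comp (mexp a)).
  exact: measurable_tnth.
have mI : measurable_fun setT (fun x : d.-tuple (measurableTypeR R) =>
    (expR (- (enorm (vec x) `^ 1) / 2))%:E).
  apply/measurable_EFinP; apply: measurableT_comp => //.
  apply: measurable_funM => //; apply: measurable_funN.
  apply: (@measurableT_comp _ _ _ _ _ _ (@powR R ^~ 1)).
    exact: measurable_powR.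
  exact: measurable_enorm_vec.
have lo : (((2 / (1 / 2)) ^+ d)%:E <= I)%E.
  rewrite -intE//; apply: ge0_le_integral => // x _.
  rewrite lee_fin ler_expR powRr1 ?enorm_ge0//.
  have := enorm_le_sum (vec x); lra.
(* An upper bound is required for finiteness, since [fine] sends an infinite integral to 0; it uses
   [sum_i |x_i| <= d |x|]. *)
have hi : (I <= ((2 / (d%:R^-1 / 2)) ^+ d)%:E)%E.
  rewrite -intE ?divr_gt0 ?invr_gt0 ?ltr0n//; apply: ge0_le_integral => // x _.
  rewrite lee_fin ler_expR powRr1 ?enorm_ge0//.
  have := sum_le_enorm (vec x).
  rewrite -ler_pdivrMl ?ltr0n// => h; rewrite mulNr lerN2 mulrAC.
  by rewrite ler_wpM2r.
have I_fin : I \is a fin_num.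
  rewrite ge0_fin_numE ?(le_lt_trans hi) ?ltry//.
  by apply: le_trans lo; rewrite lee_fin exprn_ge0// divr_ge0.
rewrite -lee_fin fineK//; apply: le_trans lo.
by rewrite lee_fin (_ : 2 / (1 / 2) = 4 :> R)//; field.
Qed.

(** The intervals [[1/(n+2), 1]] increase to []0, 1]], and on each of them [2 x^(1/2)] is an
    antiderivative. The shift by 2 keeps the left end strictly below 1. *)
Lemma integral_powRN12_itv01 :
  (\int[mu]_(x in `]0%R, 1%R]) (x `^ (- 2^-1))%:E <= 2%:E)%E.
Proof.
have mf : measurable_fun setT (fun x : R => (x `^ (- 2^-1))%:E).
  by apply/measurable_EFinP; exact: measurable_powR.
pose F (n : nat) : set R := `[n.+2%:R^-1, 1]%classic.
have FE : `]0, 1]%classic = \bigcup_n F n.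
  apply/seteqP; split => x /=; rewrite in_itv/=.
    move=> /andP[x0 x1]; have [n nx] : exists n, n.+1%:R^-1 < x.
      near \oo => n; exists n; near: n.
      exact: near_infty_natSinv_lt (PosNum x0).
    exists n => //; rewrite /F/= in_itv/= x1 andbT ltW// (le_lt_trans _ nx)//.
    by rewrite lef_pV2 ?posrE// ler_nat.
  move=> [n _]; rewrite /F/= in_itv/= => /andP[nx ->]; rewrite andbT.
  by apply: lt_le_trans nx; rewrite invr_gt0.
have ndF : nondecreasing_seq F.
  apply/nondecreasing_seqP => n; rewrite subsetEset => x.
  rewrite /F/= !in_itv/= => /andP[nx ->]; rewrite andbT.
  by apply: le_trans nx; rewrite lef_pV2 ?posrE// ler_nat.
have cvgF := @ge0_nondecreasing_set_cvg_integral _ (measurableTypeR R) R F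
  (fun x : R => (x `^ (- 2^-1))%:E) mu ndF.
have {}cvgF := cvgF (fun n => measurable_itv _) (fun n => measurable_funTS mf).
have {}cvgF := cvgF (fun n x _ => powR_ge0 _ _).
rewrite FE -(cvg_lim _ cvgF)//.
apply: lime_le; first by apply/cvg_ex; eexists; exact: cvgF.
apply: nearW => n.
have n0 : 0 < n.+2%:R^-1 :> R by rewrite invr_gt0.
have dpow (r x : R) : 0 < x -> is_derive x 1 (@powR R ^~ r) (r * x `^ (r - 1)).
  exact: is_derive1_powR.
have cpow (r x : R) : 0 < x -> {for x, continuous (@powR R ^~ r)}.
  move=> xgt0; apply/differentiable_continuous/derivable1_diffP.
  by have [] := dpow r x xgt0.
have dF (x : R) : 0 < x -> is_derive x 1 (fun x => 2 * x `^ 2^-1) (x `^ (- 2^-1)).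
  move=> x0; have := is_deriveZ (2 : R) (dpow 2^-1 x x0).
  rewrite (_ : _ *: _ = x `^ (- 2^-1)) //.
  rewrite /GRing.scale/= mulrA divff// mul1r; congr (_ `^ _).
  by field.
rewrite /F (@continuous_FTC2 _ _ (fun x => 2 * x `^ 2^-1)).
- by rewrite powR1 mulr1 -EFinB lee_fin gerBl mulr_ge0// powR_ge0.
- by rewrite invf_lt1// ltr1n.
- apply: continuous_in_subspaceT => x; rewrite inE/= in_itv/= => /andP[nx _].
  by apply: cpow; exact: lt_le_trans nx.
- have cF (x : R) : 0 < x -> {for x, continuous (fun x => 2 * x `^ 2^-1)}.
    by move=> x0; apply: cvgM; [exact: cvg_cst|exact: cpow].
  split.
  + move=> x; rewrite in_itv/= => /andP[nx _].
    by have := dF x (lt_trans n0 nx) => -[].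
  + by apply/cvg_at_right_filter; exact: cF.
  + by apply/cvg_at_left_filter; exact: cF.
- move=> x; rewrite in_itv/= => /andP[nx _].
  by have := dF x (lt_trans n0 nx) => -[_ <-]; rewrite derive1E.
Unshelve. all: by end_near. Qed.

Let Gamma_fun (r x : R) : R := x `^ r * expR (- x).

Let measurable_Gamma_fun r (D : set R) : measurable_fun D (Gamma_fun r).
Proof.
apply: measurable_funTS; apply: measurable_funM; first exact: measurable_powR.
by apply: measurableT_comp => //; exact: measurable_funN.
Qed.

(** The integrand is dominated by [x^(-1/2)] on []0, 1]] and by [2 exp (- x / 2)] beyond. The range
    of [r] covers [d/2 - 1] for [d = 1, 2, 3]. *)
Lemma Gamma_fun_lty r : - 2^-1 <= r <= 2^-1 ->
  (\int[mu]_(x in `]0%R, +oo[) (Gamma_fun r x)%:E < +oo)%E.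
Proof.
move=> /andP[r1 r2].
pose g1 := (fun x : R => (x `^ (- 2^-1))%:E) \_ `]0%R, 1%R].
pose g2 (x : R) := (2%:E * (expR (- (2^-1 * x)))%:E)%E.
have mI : measurable (`]0, +oo[%classic : set R) by exact: measurable_itv.
have g10 x : (0 <= g1 x)%E by apply: erestrict_ge0 => y _; rewrite lee_fin powR_ge0.
have g20 x : (0 <= g2 x)%E by rewrite mule_ge0// lee_fin expR_ge0.
have mg1 : measurable_fun setT g1.
  apply/(measurable_restrictT _ _).1; first exact: measurable_itv.
  by apply/measurable_EFinP; apply: measurable_funTS; exact: measurable_powR.
have mexp : measurable_fun setT (fun x : R => (expR (- (2^-1 * x)))%:E).
  by apply/measurable_EFinP; exact: measurable_expR_scale.
have mg2 : measurable_fun setT g2 by exact: emeasurable_funM.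
apply: (@le_lt_trans _ _ (\int[mu]_(x in `]0%R, +oo[) (g1 x + g2 x))%E).
  apply: ge0_le_integral => //.
  - by move=> x _; rewrite lee_fin mulr_ge0 ?powR_ge0 ?expR_ge0.
  - by apply/measurable_EFinP; exact: measurable_Gamma_fun.
  - by apply: measurable_funTS; exact: emeasurable_funD.
  move=> x; rewrite /= in_itv/= andbT => x0.
  have [x1|x1] := leP x 1.
    apply: (@le_trans _ _ (g1 x)); last by rewrite leeDl.
    rewrite /g1 patchE mem_set/=; last by rewrite in_itv/= x0.
    rewrite lee_fin /Gamma_fun -[leRHS]mulr1; apply: ler_pM; rewrite ?powR_ge0 ?expR_ge0//.
      by rewrite ger_powR// x0 x1.
    by rewrite -expR0 ler_expR oppr_le0 ltW.
  apply: (@le_trans _ _ (g2 x)); last by rewrite leeDr.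
  (* For [x > 1] and [r <= 1] one has [x^r <= x], and [x <= 2 exp (x / 2)] follows from
     [exp v >= 1 + v]. *)
  rewrite lee_fin /Gamma_fun; apply: (@le_trans _ _ (x * expR (- x))).
    rewrite ler_wpM2r ?expR_ge0// -[leRHS](powRr1 (ltW x0)) ler_powR ?ltW//.
    lra.
  rewrite (_ : - x = - (2^-1 * x) + - (2^-1 * x)); last by field.
  rewrite expRD mulrA ler_wpM2r ?expR_ge0// expRN ler_pdivrMr ?expR_gt0//.
  have := expR_ge1Dx (2^-1 * x); lra.
rewrite ge0_integralD//; last 2 first.
- exact: measurable_funTS.
- exact: measurable_funTS.
apply: lte_add_pinfty.
  rewrite -integral_mkcondr (_ : _ `&` _ = `]0, 1]%classic).
    by apply: (le_lt_trans integral_powRN12_itv01); exact: ltry.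
  apply/seteqP; split => x /=; rewrite !in_itv/= andbT; first by case.
  by move=> /andP[x0 x1]; rewrite x0 x1.
rewrite ge0_integralZl//; last exact: measurable_funTS.
by rewrite integral_expR_itv// -EFinM ltry.
Qed.

Lemma Gamma_ge (z L : R) : 2^-1 <= z <= 3 / 2 ->
  (L%:E <= \int[mu]_(x in `]0%R, +oo[) (Gamma_fun (z - 1) x)%:E)%E ->
  L <= Gamma z.
Proof.
move=> /andP[z1 z2] LG; rewrite /Gamma /Rintegral.
have Goo : (\int[mu]_(x in `]0%R, +oo[) (Gamma_fun (z - 1) x)%:E < +oo)%E.
  by apply: Gamma_fun_lty; apply/andP; split; lra.
rewrite -lee_fin fineK// ge0_fin_numE// integral_ge0// => x _.
by rewrite lee_fin mulr_ge0 ?powR_ge0 ?expR_ge0.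
Qed.

(** The values 1, 1/2, 1/4 are crude lower bounds for [sqrt pi], 1, [sqrt pi / 2], just enough for
    [c_d <= 4^d]. *)
Lemma Gamma_half_ge d : (1 <= d <= 3)%N -> 2 / 2 ^+ d <= Gamma (d%:R / 2 : R).
Proof.
have mI : measurable (`]0, +oo[%classic : set R) by exact: measurable_itv.
have mexp a : measurable_fun (`]0, +oo[%classic : set R) (fun x : R => (expR (- (a * x)))%:E).
  by apply/measurable_EFinP; apply: measurable_funTS; exact: measurable_expR_scale.
have m1 := mexp 1; have m2 := mexp 2.
case: d => [//|[|[|[|//]]]] _; apply: Gamma_ge; try by apply/andP; split; lra.
- have -> : ((2 / 2 ^+ 1)%:E = \int[mu]_(x in `]0%R, +oo[) (2%:E * (expR (- (2 * x)))%:E))%E.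
    by rewrite ge0_integralZl// integral_expR_itv// -EFinM expr1.
  apply: ge0_le_integral => //.
  - exact: emeasurable_funM.
  - by apply/measurable_EFinP; exact: measurable_Gamma_fun.
  move=> x; rewrite /= in_itv/= andbT => x0; rewrite -EFinM lee_fin /Gamma_fun.
  rewrite (_ : 1 / 2 - 1 = - 2^-1); last by field.
  rewrite powRN (_ : 2 * x = x + x) ?opprD ?expRD; last by ring.
  rewrite mulrA ler_wpM2r ?expR_ge0// -[leRHS]mul1r ler_pdivlMr ?powR_gt0//.
  rewrite mulrAC expRN ler_pdivrMr ?expR_gt0// mul1r.
  (* [x^(-1/2) >= 2 exp (- x)], because [exp x >= 1 + x >= 2 x^(1/2)] *)
  apply: le_trans (expR_ge1Dx x); set u := x `^ 2^-1.
  have -> : x = u ^+ 2.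
    by rewrite /u -powR_mulrn ?powR_ge0// -powRrM mulVf// powRr1// ltW.
  by rewrite -subr_ge0 (_ : _ - _ = (u - 1) ^+ 2) ?sqr_ge0//; ring.
- apply: (@le_trans _ _ (1^-1)%:E).
    by rewrite lee_fin; lra.
  rewrite -integral_expR_itv//; apply: ge0_le_integral => //.
  - by apply/measurable_EFinP; exact: measurable_Gamma_fun.
  - move=> x; rewrite /= in_itv/= andbT => x0; rewrite lee_fin /Gamma_fun.
    by rewrite divff// subrr powRr0 mul1r mul1r.
(* [x^(1/2) >= 1 - exp (- x)], multiplied by [exp (- x)] and integrated *)
- have h : ((1^-1)%:E <= \int[mu]_(x in `]0%R, +oo[) (Gamma_fun (3 / 2 - 1) x)%:E + (2^-1)%:E)%E.
    rewrite -(@integral_expR_itv _ 1)// -(@integral_expR_itv _ 2)// -ge0_integralD//; last 2 first.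
    - by move=> x x0; rewrite lee_fin mulr_ge0 ?powR_ge0 ?expR_ge0.
    - by apply/measurable_EFinP; exact: measurable_Gamma_fun.
    apply: ge0_le_integral => //.
    - by apply: emeasurable_funD => //; apply/measurable_EFinP; exact: measurable_Gamma_fun.
    move=> x; rewrite /= in_itv/= andbT => x0; rewrite -EFinD lee_fin /Gamma_fun.
    rewrite (_ : 3 / 2 - 1 = 2^-1); last by field.
    rewrite mul1r (_ : 2 * x = x + x) ?opprD ?expRD; last by ring.
    rewrite -mulrDl ler_peMl ?expR_ge0//.
    have e1 := expR_ge1Dx (- x).
    have [x1|x1] := leP 1 x.
      have : 1 <= x `^ 2^-1 by rewrite -[leLHS](powRr0 x) ler_powR.
      have := expR_ge0 (- x); lra.
    have : x <= x `^ 2^-1.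
      by rewrite -[leLHS](powRr1 (ltW x0)) ger_powR ?x0 ?ltW// invf_lt1// ltr1n.
    lra.
  move: h; set I := (\int[mu]_(_ in _) _)%E => h.
  have : ((1^-1 - 2^-1)%:E <= I)%E by rewrite EFinB leeBlDr.
  by apply: le_trans; rewrite lee_fin !exprS expr0; lra.
Qed.

(** With [pi <= 4] the numerator is at most [2 * 2^d], while the Gamma factor is at least
    [2 / 2^d]. *)
Lemma c_d_bounds d : (1 <= d <= 3)%N -> 0 < (c_d d : R) <= 4 ^+ d.
Proof.
move=> d13; have G := Gamma_half_ge d13.
have G0 : 0 < Gamma (d%:R / 2 : R).
  by apply: lt_le_trans G; rewrite divr_gt0// exprn_gt0.
have pid : pi `^ (d%:R / 2) <= 2 ^+ d :> R.
  have -> : 2 ^+ d = 4 `^ (d%:R / 2) :> R.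
    rewrite (_ : 4 = 2 `^ 2%:R); last by rewrite powR_mulrn// expr2 -natrM.
    by rewrite -powRrM (_ : 2%:R * (d%:R / 2) = d%:R) ?powR_mulrn//; field.
  apply: ge0_ler_powR; rewrite ?nnegrE ?pi_ge0//.
  by have /andP[_] := pihalf_02 R; lra.
rewrite /c_d divr_gt0 ?mulr_gt0 ?powR_gt0 ?pi_gt0//=.
rewrite ler_pdivrMr//; apply: (@le_trans _ _ (4 ^+ d * (2 / 2 ^+ d))); last first.
  by rewrite ler_wpM2l// exprn_ge0.
rewrite (_ : 4 ^+ d = 2 ^+ d * 2 ^+ d :> R); last by rewrite -exprMn -natrM.
by rewrite mulrCA -[in leRHS]mulrA divff ?expf_neq0// mulr1 ler_wpM2l.
Qed.

(** For [q = 1] the constant [c_qd] is [(2^d c_0 / c_d)^(1/d)], and [c_d <= 4^d <= c_0] makes it at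
    least 2; moreover [ln 2 >= 1/2]. *)
Lemma rstar_ge1 d (r1 : R) : (1 <= d <= 3)%N -> 1 <= rstar r1 1 d.
Proof.
move=> d13; have /andP[d0 _] := d13.
have /andP[cd0 cd4] := c_d_bounds d13.
have c2 : 2 <= c_qd 1 d :> R.
  rewrite /c_qd ifT; last by lra.
  rewrite subrK mulr1.
  apply: (@le_trans _ _ ((2 ^+ d) `^ d%:R^-1)).
    by rewrite -powR_mulrn// -powRrM divff ?powRr1// pnatr_eq0 -lt0n.
  apply: ge0_ler_powR; rewrite ?nnegrE ?invr_ge0 ?exprn_ge0//.
    by rewrite divr_ge0 ?(ltW cd0)// mulr_ge0 ?exprn_ge0// (le_trans _ (c_0_1_ge d0)) ?exprn_ge0.
  rewrite -mulrA ler_peMr ?exprn_ge0// ler_pdivlMr// mul1r.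
  exact: le_trans cd4 (c_0_1_ge d0).
have ln2 : 2^-1 <= ln 2 :> R.
  have : ln (1 + - 2^-1) <= - 2^-1 :> R by apply: le_ln1Dx; lra.
  rewrite (_ : 1 + - 2^-1 = 2^-1); last by field.
  by rewrite lnV ?posrE// lerN2.
rewrite /rstar; apply: (@le_trans _ _ (2^-1 * 2)); first by rewrite mulVf.
by apply: ler_pM => //; rewrite le_max c2 orbT.
Qed.

End constants.

(** * Moments of the coefficients *)

Section moments.
Context {R : realType}.

(** The linear term is absorbed with room to spare: for [q = 1] because [p < 1/2], for [q > 1]
    because [y^q] outgrows every multiple of [y]. *)
Lemma exponential_tail (p q : R) : 0 < p -> 1 <= q -> (q = 1 -> p < 2^-1) ->
  exists2 e : R, 0 < e & exists K : R, forall y, 0 <= y ->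
    p * y + - (y `^ q) / 2 <= K + - (e * y).
Proof.
move=> p0; rewrite le_eqVlt => /predU1P[<- /(_ erefl) p2|q1 _].
  exists (2^-1 - p); first by rewrite subr_gt0.
  by exists 0 => y y0; rewrite powRr1//; lra.
(* With [e = 1] the claim is [A y <= y^q + 2 K]. Beyond [A^(1/(q-1))] one has [y^(q-1) >= A]; below
   it the constant dominates [A y]. *)
pose A := 2 * (p + 1); have A0 : 0 < A by rewrite /A; lra.
exists 1 => //; exists (A / 2 * A `^ (q - 1)^-1) => y y0.
have q10 : 0 < q - 1 by rewrite subr_gt0.
suff : A * y <= y `^ q + A * A `^ (q - 1)^-1 by rewrite {1}/A; lra.
clearbody A.
have [yA|Ay] := leP y (A `^ (q - 1)^-1).
  by rewrite ler_wpDl ?powR_ge0// ler_wpM2l// ltW.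
rewrite ler_wpDr ?mulr_ge0 ?powR_ge0 ?(ltW A0)//.
have {}y0 : 0 < y by apply: lt_trans Ay; rewrite powR_gt0.
have -> : y `^ q = y `^ (q - 1) * y.
  by rewrite -[X in _ * X](powRr1 (ltW y0)) -powRD ?subrK// (gt_eqF y0) implybT.
rewrite ler_wpM2r ?(ltW y0)//.
have -> : A = (A `^ (q - 1)^-1) `^ (q - 1).
  by rewrite -powRrM mulVf ?gt_eqF// powRr1// ltW.
by apply: ge0_ler_powR; rewrite ?nnegrE ?powR_ge0 ?ltW.
Qed.

(** [D] is fixed before the random variable, so one constant serves all coefficients [xi l]. *)
Lemma exponential_moment_le (p q c : R) : 0 < c -> 0 < p -> 1 <= q ->
  (q = 1 -> p < 2^-1) -> exists D : R,
  forall (dO : measure_display) (Omega : measurableType dO)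
    (P : probability Omega R) (xi : {RV P >-> R}),
  has_density lebesgue_measure (fun x : R => c * expR (- (`|x| `^ q) / 2))
    (distribution P xi) ->
  (\int[P]_w (expR (p * `|xi w|))%:E <= D%:E)%E.
Proof.
move=> c0 p0 q1 pq; have [e e0 [K Ktail]] := exponential_tail p0 q1 pq.
exists (c * expR K * (2 / e)) => dO Omega P xi xi_density.
have mexp : measurable_fun setT (fun x : R => (expR (p * `|x|))%:E).
  apply/measurable_EFinP; apply: measurableT_comp => //.
  exact: measurable_funM.
have mexpN : measurable_fun setT (fun x : R => (expR (- (e * `|x|)))%:E).
  apply/measurable_EFinP; apply: measurableT_comp => //.
  by apply: measurable_funN; exact: measurable_funM.
have f0 (x : R) : 0 <= c * expR (- (`|x| `^ q) / 2) by rewrite mulr_ge0 ?expR_ge0 ?ltW.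
(* [lebesgue_measure] lives on [measurableTypeR R], whose measurable structure
   is only convertible, not identical, to the one of [R] *)
pose xi' : {mfun Omega >-> measurableTypeR R} :=
  HB.pack (xi : Omega -> measurableTypeR R)
    (isMeasurableFun.Build _ _ Omega (measurableTypeR R) xi (measurable_funPT xi)).
rewrite -(@ge0_integral_distribution _ _ _ _ _ P xi' _ mexp); last first.
  by move=> x; rewrite lee_fin expR_ge0.
rewrite (@ge0_integral_density _ _ _ (@lebesgue_measure R) (distribution P xi')
  _ f0 xi_density)//.
rewrite EFinM -(integral_expR_norm e0) -ge0_integralZl//; last first.
  by rewrite lee_fin mulr_ge0 ?expR_ge0 ?ltW.
have [mf _] := xi_density.
apply: ge0_le_integral => //.
- by move=> x _; rewrite mule_ge0 ?lee_fin ?expR_ge0.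
- by apply: emeasurable_funM => //; exact/measurable_EFinP.
- exact: emeasurable_funM.
move=> x _; rewrite -!EFinM lee_fin mulrCA -mulrA -!expRD.
by rewrite ler_wpM2l ?(ltW c0)// ler_expR Ktail.
Qed.

End moments.

(** * Support and exponential moment of the prior *)

Section prior.
Context {R : realType} {d : nat} (psi : nat -> 'rV[R]_d -> R).
Hypothesis psi_basis : @orthonormal_basis R d (@torus R d) nat psi.
Context (X : completeNormedModType R) (s t q kappa : R).
Variables (iota : (('rV[R]_d -> R) -> R) -> X) (ce : R).
Hypothesis iota_embedding : continuous_embedding psi t iota ce.
Variable mu0 : probability (borel X) R.
Hypothesis mu0P : besov_measure psi s q kappa iota mu0.
Hypothesis q_ge1 : 1 <= q.
Hypothesis gamma_gt0 : 0 < (s - t) / d%:R - q^-1.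
Variable alpha : R.
Hypothesis alpha_gt0 : 0 < alpha.
Hypothesis kappa_gt : q = 1 -> 2 * ce * alpha < kappa.

Let cq : R := kappa^-1 `^ q^-1.
(** By [prior_series_le], [alpha] times the norm of a draw is at most [beta] times any bound on all
    [(l+1)^(- gamma) |xi_l|]. *)
Let beta := alpha * (Num.max ce 0 * cq).

(** For [q = 1] the rate is [beta = alpha max(ce, 0) / kappa], which [kappa_gt] puts below 1/2, and
    [p] is the midpoint of [b] and 1/2; otherwise [p] is unrestricted. *)
Lemma moment_exponents : exists b p : R,
  [/\ 0 < b, beta <= b, b < p & q = 1 -> p < 2^-1].
Proof.
have [kappa0 _] := mu0P.
have [q1|q1] := eqVneq q 1; last first.
  exists (Num.max beta 1), (Num.max beta 1 + 1); split => //.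
  - by rewrite lt_max ltr01 orbT.
  - by rewrite le_max lexx.
  - by rewrite ltrDl.
  - by move=> /eqP; rewrite (negbTE q1).
have beta_lt : beta < 2^-1.
  rewrite /beta /cq q1 invr1 powRr1 ?invr_ge0 ?(ltW kappa0)// mulrA.
  rewrite ltr_pdivrMr// maxr_pMr ?(ltW alpha_gt0)// mulr0 gt_max.
  apply/andP; split; last by rewrite mulr_gt0.
  by have := kappa_gt q1; lra.
(* The value 1/4 keeps [b] positive when [beta] vanishes. *)
pose b := Num.max beta 4^-1.
have b2 : b < 2^-1 by rewrite gt_max beta_lt /=; lra.
exists b, ((b + 2^-1) / 2); split.
- by rewrite lt_max invr_gt0 ltr0n orbT.
- by rewrite le_max lexx.
- lra.
- by move=> _; lra.
Qed.

Lemma prior_support_and_moment :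
  mu0 (~` closure (range (rational_prior_series psi s q kappa iota))) = 0%E /\
  (\int[mu0]_u (expR (alpha * `|u : X|))%:E < +oo)%E.
Proof.
have [kappa0 [dO [Om [P [xi [U mu0P']]]]]] := mu0P.
have [_ xi_dens U_series mu0E] := mu0P'; have [c c0 xi_density] := xi_dens.
have [b [p [b0 betab bp pq]]] := moment_exponents.
have p0 := lt_trans b0 bp.
have [D moment] := exponential_moment_le c0 p0 q_ge1 pq.
have {}moment l := moment _ _ P (xi l) (xi_density l).
set gamma := (s - t) / d%:R - q^-1; have g_gt0 : 0 < gamma := gamma_gt0.
have g0 : 0 < gamma / 2 by rewrite divr_gt0.
(* The weight [gamma / 2] serves both claims: [prior_series_closure] asks for it, and it dominates
   the weight [gamma] of the norm bound. *)
pose V := exp_series xi b p (gamma / 2).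
have V0 w : (0 <= V w)%E by exact: exp_series_ge0.
have mV : measurable_fun setT V by exact: measurable_exp_series.
have Voo : (\int[P]_w V w < +oo)%E := exp_series_lty b0 bp g0 moment.
have V_ae : {ae P, forall w, (V w < +oo)%E}.
  have /integrable_ae : P.-integrable setT V.
    by apply/integrableP; split => //; under eq_integral do rewrite gee0_abs//.
  by move=> /(_ measurableT); apply: filterS => w /(_ I); rewrite ge0_fin_numE.
have S_ae : {ae P, forall w, closure (range (rational_prior_series psi s q kappa iota)) (U w)}.
  apply: filterS2 U_series V_ae => w -> Vw.
  apply: (prior_series_closure psi_basis iota_embedding g_gt0) => l.
  exact: (exp_series_weighted b0 bp g0 l Vw).
have U_ae : {ae P, forall w, ((expR (alpha * `|U w : X|))%:E <= (expR 1)%:E + V w)%E}.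
  apply: filterS2 U_series V_ae => w Uw Vw.
  have w_fin : V w \is a fin_num by rewrite ge0_fin_numE.
  have w0 : 0 <= fine (V w) by rewrite fine_ge0.
  have eV1 : 1 <= expR 1 + fine (V w).
    by rewrite ler_wpDr// -expR0 ler_expR.
  rewrite -(fineK w_fin) -EFinD lee_fin -[leRHS]lnK ?posrE ?(lt_le_trans ltr01)//.
  rewrite ler_expR.
  have xB (l : nat) : l.+1%:R `^ (- gamma) * `|xi l w| <=
      ln (expR 1 + fine (V w)) / b.
    apply: le_trans (exp_series_weighted b0 bp g0 l Vw).
    rewrite ler_wpM2r// ler_powR ?ler1n// lerN2 ler_pdivrMr//.
    by rewrite ler_peMr ?ler1n// ltW.
  have := prior_series_le psi_basis kappa iota_embedding xB.
  rewrite /prior_series -Uw -/cq => UB.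
  apply: (le_trans (ler_wpM2l (ltW alpha_gt0) UB)).
  rewrite (_ : alpha * _ = beta / b * ln (expR 1 + fine (V w))); last first.
    by rewrite /beta; ring.
  by rewrite ler_piMl ?ln_ge0// ler_pdivrMr// mul1r.
split.
  have mS : measurable (~` closure (range (rational_prior_series psi s q kappa iota)) : set (borel X)).
    by apply: measurableC; apply: closed_measurable_borel; exact: closed_closure.
  rewrite mu0E// /distribution /pushforward.
  have mpre : measurable (U @^-1` (~` closure (range (rational_prior_series psi s q kappa iota)))).
    by rewrite -[X in measurable X]setTI; exact: measurable_funP.
  by apply/negligibleP.
have mexp : measurable_fun setT (fun u : borel X => (expR (alpha * `|u : X|))%:E).
  apply/measurable_EFinP; apply: continuous_measurable_borel => u.
  apply: (continuous_comp (f := fun u : X => alpha * `|u|)); last exact: continuous_expR.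
  by apply: cvgM; [exact: cvg_cst|exact: norm_continuous].
rewrite (eq_measure_integral (distribution P U)); last by move=> A mA _; exact: mu0E.
rewrite ge0_integral_distribution//.
apply: (@le_lt_trans _ _ (\int[P]_w ((expR 1)%:E + V w))%E).
  apply: ae_ge0_le_integral => //.
  - by move=> w _; rewrite lee_fin expR_ge0.
  - exact: (measurableT_comp mexp (measurable_funPT U)).
  - by move=> w _; rewrite adde_ge0// lee_fin expR_ge0.
  - exact: emeasurable_funD.
  - by apply: filterS U_ae.
rewrite ge0_integralD//.
rewrite integral_cst//; apply: lte_add_pinfty => //; apply: lte_mul_pinfty => //.
by apply: (le_lt_trans (probability_le1 P measurableT)); exact: ltry.
Qed.

End prior.

Theorem theorem3p2 (R : realType) (d : nat) (d_range : (1 <= d <= 3)%N)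
  (X Y : completeNormedModType R)
  (G : X -> Y) (Q0 : probability (borel Y) R) (Phi : X -> Y -> R)
  (Q_ac : forall u, data_law G Q0 u `<< Q0)
  (Q_density : forall u,
     has_density Q0 (fun y : borel Y => expR (- Phi u y)) (data_law G Q0 u))
  (Q_mass : forall u, (\int[Q0]_y (expR (- Phi u y))%:E = 1)%E)
  (alpha1 : R) (alpha1_gt0 : 0 < alpha1)
  (Phi_lower : forall r : R, 0 < r -> exists M : R,
     forall (u : X) (y : Y), `|y| < r -> M - alpha1 * `|u| <= Phi u y)
  (Phi_upper : forall r : R, 0 < r -> exists2 K : R, 0 < K &
     forall (u : X) (y : Y), Num.max `|u| `|y| < r -> Phi u y <= K)
  (Phi_lip : forall r : R, 0 < r -> exists2 L : R, 0 < L &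
     forall (u1 u2 : X) (y : Y),
       Num.max (Num.max `|u1| `|u2|) `|y| < r ->
       `|Phi u1 y - Phi u2 y| <= L * `|u1 - u2|)
  (s t q : R) (q_ge1 : 1 <= q) (s_gt : t + d%:R / q < s)
  (rho : nat) (rho_gt : s < rho%:R)
  (psi : nat -> 'rV[R]_d -> R) (psi_wavelet : wavelet_basis rho psi)
  (iota : (('rV[R]_d -> R) -> R) -> X) (ce : R)
  (iota_embedding : continuous_embedding psi t iota ce)
  (r1 : R) (r1P : r1_condition s t d q r1)
  (kappa : R) (kappa_gt : 2 * ce * rstar r1 q d * alpha1 < kappa)
  (mu0 : probability (borel X) R)
  (mu0P : besov_measure psi s q kappa iota mu0)
  (joint : probability (borel X * borel Y)%type R)
  (jointP : joint_law mu0 (data_law G Q0) joint) :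
  [/\ forall y : Y, (evidence mu0 Phi y < +oo)%E,
      exists mu : R.-pker (borel Y) ~> (borel X),
        conditional_law joint mu /\
        forall y : Y, bayes_formula mu0 Phi y (mu y)
    & forall mu : R.-pker (borel Y) ~> (borel X),
        conditional_law joint mu ->
        {ae pushforward joint snd, forall y : borel Y,
           bayes_formula mu0 Phi y (mu y)}].
Proof.
have /andP[d1 _] := d_range.
have d0 : 0 < d%:R :> R by rewrite ltr0n.
have gamma_gt0 : 0 < (s - t) / d%:R - q^-1.
  have q0 : 0 < q by exact: lt_le_trans q_ge1.
  rewrite (_ : _ - _ = (s - (t + d%:R / q)) / d%:R); last first.
    by field; rewrite !gt_eqF.
  by rewrite divr_gt0// subr_gt0.
have [psi_basis _] := psi_wavelet.
have kappa_gt0 : 0 < kappa by case: mu0P.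
have kappa_gt1 : q = 1 -> 2 * ce * alpha1 < kappa.
  (* For [ce <= 0] the threshold is not positive; for [ce > 0] it is enlarged by the factor
     [rstar >= 1]. *)
  move=> q1; have [ce0|ce0] := leP ce 0.
    apply: le_lt_trans kappa_gt0; rewrite mulr_le0_ge0 ?(ltW alpha1_gt0)//.
    by rewrite mulr_ge0_le0.
  apply: le_lt_trans kappa_gt; rewrite q1 ler_wpM2r ?(ltW alpha1_gt0)//.
  by rewrite ler_peMr ?mulr_ge0 ?(ltW ce0)// rstar_ge1.
have [mu0_supp mu0_moment] := prior_support_and_moment psi_basis iota_embedding
  mu0P q_ge1 gamma_gt0 alpha1_gt0 kappa_gt1.
(* The potential is recovered from its measurable density as [- ln]. *)
have Phi_meas u : measurable_fun setT (Phi u : borel Y -> R).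
  have [mexp _] := Q_density u.
  rewrite (_ : Phi u = -%R \o (@ln R \o (fun y : borel Y => expR (- Phi u y)))).
    by apply: measurableT_comp => //; apply: measurableT_comp.
  by apply/funext => y /=; rewrite expRK opprK.
have Phi_cont y : continuous (Phi ^~ y).
  (* This radius leaves room for [y], [u] and every [v] within distance 1 of [u], so one Lipschitz
     constant works near [u]. *)
  move=> u; pose r := `|u| + `|y| + 2.
  have r0 : 0 < r by rewrite ltr_wpDl.
  have [L L0 PhiL] := Phi_lip _ r0.
  apply/cvgrPdist_lt => e e0.
  have eL : 0 < Num.min 1 (e / L) by rewrite lt_min ltr01 divr_gt0.
  near=> v.
  have : `|u - v| < Num.min 1 (e / L).
    by near: v; apply: cvgr_dist_lt => //; exact: cvg_id.
  rewrite lt_min => /andP[uv1 uve].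
  apply: (@le_lt_trans _ _ (L * `|u - v|)); last by rewrite mulrC -ltr_pdivlMr.
  have vu : `|v| < `|u| + 1.
    rewrite -(subKr u v); apply: (le_lt_trans (ler_normB _ _)).
    by rewrite ltrD2l.
  apply: PhiL; rewrite /r !gt_max; have := normr_ge0 u; have := normr_ge0 y.
  by move=> y0 u0; apply/andP; split; [apply/andP; split|]; lra.
have evidence_lty y : (evidence mu0 Phi y < +oo)%E.
  (* Assumption (i) with radius [|y| + 1] bounds the likelihood by [exp (- M) exp (alpha1 |u|)],
     integrable by the exponential moment. *)
  have [M PhiM] := Phi_lower _ (ltr_wpDl (normr_ge0 y) ltr01).
  have mexp (h : X -> R) : continuous h ->
      measurable_fun setT (fun u : borel X => (expR (h u))%:E).
    move=> ch; apply/measurable_EFinP; apply: continuous_measurable_borel => u.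
    by apply: (continuous_comp (f := h)); [exact: ch|exact: continuous_expR].
  have mexpX : measurable_fun setT (fun u : borel X => (expR (alpha1 * `|u : X|))%:E).
    apply: (mexp (fun u : X => alpha1 * `|u|)) => u.
    by apply: cvgM; [exact: cvg_cst|exact: norm_continuous].
  apply: (@le_lt_trans _ _ (\int[mu0]_u ((expR (- M))%:E * (expR (alpha1 * `|u : X|))%:E))%E).
    apply: ge0_le_integral => //.
    - by apply: (mexp (fun u => - Phi u y)) => u; apply: cvgN; exact: Phi_cont.
    - exact: emeasurable_funM.
    move=> u _; rewrite -EFinM lee_fin -expRD ler_expR.
    by have := PhiM u y; rewrite ltrDl => /(_ ltr01); lra.
  rewrite ge0_integralZl//.
  by rewrite lte_mul_pinfty ?lee_fin ?expR_ge0.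
have Q_setT u : data_law G Q0 u setT = 1%E.
  by rewrite /data_law /pushforward preimage_setT probability_setT.
pose nu : {measure set (borel Y) -> \bar R} :=
  distribution joint (HB.pack (@snd (borel X) (borel Y))
    (isMeasurableFun.Build _ _ _ _ _ (@measurable_snd _ _ (borel X) (borel Y)))
    : {mfun (borel X * borel Y)%type >-> borel Y}).
split => //.
- exact: (bayes_posterior_exists mu0_supp Phi_meas Phi_cont evidence_lty
    Q_density Q_setT jointP (nu := nu)).
- move=> mu; exact: (bayes_posterior_unique mu0_supp Phi_meas Phi_cont evidence_lty
    Q_density Q_setT jointP (nu := nu)).
Unshelve. all: by end_near. Qed.
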